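(* Let $0\le k\le n$, let $\lambda=(\lambda_1,\lambda_2)$ be a partition of $k$ with at most two rows, and let $s=\ell(\lambda)$. Then the collection of polynomials $$\mathcal{C}_{n,\lambda,\ell(\lambda)}:=\{F_T^S\,e_1^{i_1}\cdots e_{n-k}^{i_{n-k}} : (S,(i_1,\dots,i_{n-k}))\in\Sigma_{n,\lambda,\ell(\lambda)},\ T\in\mathrm{SYT}_n,\ \mathrm{sh}(T)=\mathrm{sh}(S)\}$$ forms a higher Specht basis of $R_{n,\lambda,\ell(\lambda)}$.
   Context: ''Higher Specht basis of $R_{n,\lambda,s}$'' means: the listed polynomials descend to a $\mathbb{Q}$-basis of $R_{n,\lambda,s}$, and for each fixed $(S,(i_1,\dots,i_{n-k}))$ the images of the elements with $T$ ranging over $\mathrm{SYT}(\mathrm{sh}(S))$ span a copy of the irreducible $\mathfrak{S}_n$-representation (Specht module) $V_{\mathrm{sh}(S)}$. The ring: let $\lambda'=(\lambda'_1\ge\dots\ge\lambda'_n\ge0)$ be the transpose of $\lambda$ padded with zeros. For a set $A$ of variables let $e_d(A)$ be the sum of all squarefree degree-$d$ monomials in the variables of $A$, and $e_d=e_d(\{x_1,\dots,x_n\})$. $I_{n,\lambda,s}\subset\mathbb{Q}[x_1,\dots,x_n]$ is the ideal generated by $x_i^s$ ($1\le i\le n$) and all $e_d(A)$ with $A\subseteq\{x_1,\dots,x_n\}$ and $d>|A|-(\lambda'_n+\dots+\lambda'_{n-|A|+1})$; $R_{n,\lambda,s}=\mathbb{Q}[x_1,\dots,x_n]/I_{n,\lambda,s}$.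 $\mathfrak{S}_n$ acts by permuting variables. Tableaux are in French notation (first row at the bottom). $\mathrm{SYT}_n$ is the set of standard Young tableaux of size $n$ of any partition shape, $\mathrm{SYT}(\rho)$ those of shape $\rho$, $\mathrm{sh}$ denotes shape, $S|_k$ is the restriction of $S$ to entries $1,\dots,k$. The reading word $\mathrm{rw}(S)$ concatenates rows from top to bottom, each read left to right. $\mathrm{des}(S)$ is the number of $i$ such that $i+1$ lies in a strictly higher row of $S$ than $i$. Cocharge: for a permutation $w$, label the letter $1$ by $0$; if $i$ has label $c$, label $i+1$ by $c$ if it is to the right of $i$ in $w$ and by $c+1$ if to the left; the word of labels is $\mathrm{cc}(w)$. For $S\in\mathrm{SYT}_n$, $\mathrm{cc}(S)$ is the filling of $\mathrm{sh}(S)$ obtained by replacing each entry $i$ by its label in $\mathrm{rw}(S)$ (equivalently: $1$ has label $0$; $i+1$ has the label of $i$ plus $1$ if $i+1$ is in a strictly higher row than $i$, and the label of $i$ otherwise). Higher Specht polynomials: for $S,T\in\mathrm{SYT}(\rho)$, $\mathbf{x}_T^{\mathrm{cc}(S)}=\prod_{u\in\rho}x_{T(u)}^{\mathrm{cc}(S)(u)}$, $\varepsilon_T=\sum_{\tau\in C(T)}\sum_{\sigma\in R(T)}\mathrm{sgn}(\tau)\,\tau\sigma$ with $C(T),R(T)\subset\mathfrak{S}_n$ the column and row stabilizers of $T$, and $F_T^S=\varepsilon_T\cdot\mathbf{x}_T^{\mathrm{cc}(S)}$. Catabolizability type: on pairs $(x,\nu)$, where $x=ya$ is a nonempty word of nonnegative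 integers with last letter $a$ and $\nu$ is a partition, let $f(x,\nu)=(y,\nu+\epsilon_{a+1})$ if $\nu+\epsilon_{a+1}$ is a partition, and $f(x,\nu)=((a+1)y,\nu)$ otherwise ($\epsilon_j$ the $j$th unit vector; $(a+1)y$ is $y$ preceded by the letter $a+1$). Starting from $(\mathrm{cc}(w),\emptyset)$, apply $f$ until reaching $(\emptyset,\nu)$; then $\mathrm{ctype}(w)=\nu$, and $\mathrm{ctype}(S)=\mathrm{ctype}(\mathrm{rw}(S))$. $\trianglerighteq$ is dominance order. $\Sigma_{n,\lambda,s}$ is the set of pairs $(S,\mu)$ with $S\in\mathrm{SYT}_n$, $\mathrm{ctype}(S|_k)\trianglerighteq\lambda$, $\mathrm{des}(S)<s$, and $\mu$ a partition with at most $n-k$ parts and $\mu_1\le s-\mathrm{des}(S)-1$. Such $\mu$ is identified with the tuple $(i_1,\dots,i_{n-k})$ of nonnegative integers given by $i_{n-k}=\mu_{n-k}$, $i_j=\mu_j-\mu_{j+1}$ for $j<n-k$; thus the tuples allowed for $S$ are exactly those with $i_1+\dots+i_{n-k}<s-\mathrm{des}(S)$. *)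

(* Defs.v *)
From HB Require Import structures.
From mathcomp Require Import all_boot all_order all_fingroup all_algebra.
From mathcomp.multinomials Require Export mpoly.

Set Implicit Arguments.
Unset Strict Implicit.
Unset Printing Implicit Defensive.

Import GRing.Theory.

(* Partitions: weakly decreasing sequences of positive integers, with no      *)
(* trailing zeros, so that [size] is the length and [nth 0] is zero-padding.  *)

Definition is_part (nu : seq nat) : bool := sorted geq nu && (0 \notin nu).

(* The part of index [j] (counted from 0) of the transpose, padded with 0.    *)
Definition conj_part (nu : seq nat) (j : nat) : nat := count (fun r => j < r) nu.

Definition dominates (mu nu : seq nat) : bool :=
  (sumn mu == sumn nu) &&
  all (fun i => sumn (take i nu) <= sumn (take i mu))
      (iota 0 (maxn (size mu) (size nu)).+1).

(* Tableaux, given by their rows from bottom to top.  The entry [i : 'I_n]    *)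
(* stands for the entry i + 1 of the usual convention, and likewise words are *)
(* written in the letters 0, 1, ... instead of 1, 2, ...                      *)

Definition tableau (n : nat) : Type := seq (seq 'I_n).

Section Tableaux.
Variable n : nat.
Implicit Types (T S : tableau n) (i j : 'I_n).

Definition is_syt T : bool :=
  [&& is_part (shape T),
      perm_eq (flatten T) (enum 'I_n),
      all (sorted (fun i j => i < j)) T
    & sorted (fun lo up => all (fun p : 'I_n * 'I_n => p.1 < p.2) (zip lo up)) T].

Definition row_of T i : nat := find (fun r => i \in r) T.
Definition col_of T i : nat := index i (nth [::] T (row_of T i)).

Definition reading_word T : seq nat := map val (flatten (rev T)).

Definition restrict (k : nat) T : tableau n :=
  [seq r <- [seq [seq i : 'I_n <- r | i < k] | r <- T] | r != [::]].

Definition des T : nat :=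
  #|[set p : 'I_n * 'I_n | (p.2 == p.1.+1 :> nat) && (row_of T p.1 < row_of T p.2)]|.

Definition row_stab T : {set 'S_n} :=
  [set s : 'S_n | [forall i, row_of T (s i) == row_of T i]].
Definition col_stab T : {set 'S_n} :=
  [set s : 'S_n | [forall i, col_of T (s i) == col_of T i]].

End Tableaux.

(* Cocharge labels of a word [w] that is a permutation of 0, ..., size w - 1. *)

Fixpoint cc_label (w : seq nat) (i : nat) : nat :=
  if i is j.+1 then cc_label w j + (index i w < index j w) else 0.

Definition cc_word (w : seq nat) : seq nat := map (cc_label w) w.

Definition cc_tableau (n : nat) (S : tableau n) : seq (seq nat) :=
  [seq [seq cc_label (reading_word S) (val i) | i <- r] | r <- S].

(* Catabolizability type.  [incr_nth nu a] is nu + epsilon_(a+1); when a      *)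
(* exceeds [size nu] it has interior zeros, hence is not a partition.  Pairs  *)
(* with an empty word are left unchanged.                                     *)

Definition ctype_step (p : seq nat * seq nat) : seq nat * seq nat :=
  let: (x, nu) := p in
  if x is b :: x' then
    let y := belast b x' in
    let a := last b x' in
    if is_part (incr_nth nu a) then (y, incr_nth nu a) else (a.+1 :: y, nu)
  else p.

(* If iterating the step empties the word at all, then it does so within      *)
(* (size w)^2 steps: see [ctype_wordE].                                       *)
Definition ctype_word (w : seq nat) : seq nat :=
  (iter (size w * size w) ctype_step (cc_word w, [::])).2.

Definition ctype (n : nat) (S : tableau n) : seq nat := ctype_word (reading_word S).

Lemma iter_ctype_nil m nu : iter m ctype_step ([::], nu) = ([::], nu).
Proof. by elim: m => //= m ->. Qed.

Lemma ctype_step_rcons y a nu :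
  ctype_step (rcons y a, nu) =
  if is_part (incr_nth nu a) then (y, incr_nth nu a) else (a.+1 :: y, nu).
Proof.
case: y => [|b y] /=; first by [].
by rewrite belast_rcons last_rcons.
Qed.

Lemma is_part_incr_nth nu a : is_part (incr_nth nu a) -> a <= size nu.
Proof.
case/andP=> _; apply: contraR; rewrite -ltnNge => lt_a.
have sz : size (incr_nth nu a) = a.+1 by rewrite size_incr_nth ltnNge (ltnW lt_a).
have <- : nth 0 (incr_nth nu a) (size nu) = 0.
  by rewrite nth_incr_nth nth_default // gtn_eqF.
by apply: mem_nth; rewrite sz ltnS ltnW.
Qed.

Lemma iter_ctype_bound N m x nu mu :
  size x + size nu <= N ->
  iter m ctype_step (x, nu) = ([::], mu) ->
  all (fun a => a < N) x /\
  iter (sumn [seq N - a | a <- x]) ctype_step (x, nu) = ([::], mu).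
Proof.
elim: m x nu => [|m IHm] x nu szN; first by move=> /= [-> ->].
case/lastP: x szN => [|y a] szN; first by rewrite iter_ctype_nil => -[->].
rewrite iterSr ctype_step_rcons size_rcons in szN *.
have stay l k q : iter l ctype_step q = ([::], mu) -> l <= k ->
    iter k ctype_step q = ([::], mu).
  by move=> itl /subnK <-; rewrite iterD itl iter_ctype_nil.
have fuel : sumn [seq N - b | b <- rcons y a] = sumn [seq N - b | b <- y] + (N - a).
  by rewrite map_rcons -cats1 sumn_cat /= addn0.
case: ifP => [part_a|npart_a] /IHm[].
- rewrite size_incr_nth; case: ifP => _; first by apply: leq_trans szN; rewrite leq_add2r.
  have := is_part_incr_nth part_a; move: szN; rewrite addSnnS => szN le_a.
  by apply: leq_trans szN; rewrite leq_add2l.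
- move=> ally ity; have lt_a : a < N.
    apply: leq_ltn_trans (is_part_incr_nth part_a) _.
    by apply: leq_trans szN; rewrite addSn ltnS leq_addl.
  rewrite all_rcons ally lt_a; split=> //.
  rewrite fuel -(prednK (_ : 0 < N - a)) ?subn_gt0 // addnS iterSr ctype_step_rcons part_a.
  by apply: stay ity _; rewrite leq_addr.
- by rewrite /= addSn.
- case=> /andP[lt_a ally] ity; split; first by rewrite all_rcons (ltnW lt_a).
  rewrite fuel -(prednK (_ : 0 < N - a)) ?subn_gt0 ?(ltnW lt_a) //.
  rewrite addnS iterSr ctype_step_rcons npart_a.
  by rewrite -subnS addnC in ity *.
Qed.

Lemma ctype_wordE w m nu :
  iter m ctype_step (cc_word w, [::]) = ([::], nu) -> ctype_word w = nu.
Proof.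
have szw : size (cc_word w) = size w by rewrite size_map.
move/(@iter_ctype_bound (size w)); rewrite /= addn0 szw => /(_ (leqnn _)) [_ itw].
rewrite /ctype_word.
have le_s : sumn [seq size w - a | a <- cc_word w] <= size w * size w.
  rewrite -[X in _ <= X * _]szw; elim: (cc_word w) => //= a t IHt.
  by rewrite mulSn leq_add // leq_subr.
by rewrite -(subnK le_s) iterD itw iter_ctype_nil.
Qed.

(* Here k = |la|.  [part_exp mu j] is i_(j+1) = mu_(j+1) - mu_(j+2) in the    *)
(* tuple (i_1, ..., i_(n-k)) identified with mu; as mu has at most n-k parts, *)
(* the padding gives i_(n-k) = mu_(n-k).                                      *)

Definition Sigma (n : nat) (la : seq nat) (s : nat) (p : tableau n * seq nat) : bool :=
  let S := p.1 in let mu := p.2 in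
  [&& is_syt S, dominates (ctype (restrict (sumn la) S)) la, des S < s,
      is_part mu, size mu <= n - sumn la & nth 0 mu 0 <= s - des S - 1].

Definition part_exp (mu : seq nat) (j : nat) : nat := nth 0 mu j - nth 0 mu j.+1.

Local Open Scope ring_scope.

Definition in_ideal (A : nzRingType) (gen : A -> Prop) (p : A) : Prop :=
  exists2 r : seq (A * A), (forall g, g \in r -> gen g.2) &
                           p = \sum_(g <- r) g.1 * g.2.

Section Polynomials.
Variable n : nat.
Local Notation poly := {mpoly rat[n]}.

Definition esym_in (A : {set 'I_n}) (d : nat) : poly :=
  \sum_(B : {set 'I_n} | (B \subset A) && (#|B| == d)) \prod_(i in B) 'X_i.

(* The condition on d is d > |A| - (la'_n + ... + la'_(n-|A|+1)).             *)
Definition I_gen (la : seq nat) (s : nat) (p : poly) : Prop :=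
  (exists i : 'I_n, p = 'X_i ^+ s) \/
  (exists (A : {set 'I_n}) (d : nat),
     (#|A| < d + \sum_(n - #|A| <= j < n) conj_part la j)%N /\ p = esym_in A d).

Definition I_ideal (la : seq nat) (s : nat) : poly -> Prop := in_ideal (I_gen la s).

(* [msym s] sends 'X_i to 'X_(s i), so [msym tau \o msym sigma] is the action *)
(* of the product tau sigma, where sigma is applied first.                    *)

Definition x_cc (S T : tableau n) : poly :=
  \prod_(u <- zip (flatten T) (flatten (cc_tableau S))) 'X_(u.1) ^+ u.2.

Definition eps (T : tableau n) (p : poly) : poly :=
  \sum_(tau in col_stab T) \sum_(sigma in row_stab T)
    (-1) ^+ tau *: msym tau (msym sigma p).

Definition F_poly (S T : tableau n) : poly := eps T (x_cc S T).

Definition C_index (la : seq nat) (s : nat)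
    (q : (tableau n * seq nat) * tableau n) : bool :=
  [&& Sigma la s q.1, is_syt q.2 & shape q.2 == shape q.1.1].

Definition e_poly (la mu : seq nat) : poly :=
  \prod_(j < n - sumn la) mesym n rat j.+1 ^+ part_exp mu j.

Definition C_elt (la : seq nat) (q : (tableau n * seq nat) * tableau n) : poly :=
  F_poly q.1.1 q.2 * e_poly la q.1.2.

End Polynomials.

(* Statements about the classes in the quotient V / J of the family (F i),    *)
(* i in P, written on representatives; J is a submodule in every use.  The    *)
(* quotient is not formed because the ideal may be improper (k = 0).          *)

Section Quotient.
Variables (V : lmodType rat) (J : V -> Prop) (I : eqType) (P : pred I) (F : I -> V).

Definition in_span_mod (v : V) : Prop :=
  exists (r : seq I) (c : I -> rat), all P r /\ J (v - \sum_(i <- r) c i *: F i).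

Definition free_mod : Prop :=
  forall (r : seq I) (c : I -> rat), uniq r -> all P r ->
    J (\sum_(i <- r) c i *: F i) -> forall i, i \in r -> c i = 0.

Definition basis_mod : Prop := (forall v, in_span_mod v) /\ free_mod.

End Quotient.

(* Specht modules, spanned by the polytabloids in the permutation module on   *)
(* tabloids.  A tabloid is encoded as the function that sends each entry to   *)
(* the index of its row; there are at most n rows.                            *)

Section Specht.
Variable n : nat.

Definition tabloid : Type := {ffun 'I_n -> 'I_n.+1}.
Definition tabloid_of (t : tableau n) : tabloid := [ffun i => inord (row_of t i)].
Definition act_tabloid (s : 'S_n) (f : tabloid) : tabloid := [ffun i => f (s^-1%g i)].

Definition tabmod : Type := {ffun {ffun 'I_n -> 'I_n.+1} -> rat^o}.
HB.instance Definition _ := Vector.on tabmod.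

Definition tabvec (f : tabloid) : tabmod := [ffun g => (g == f)%:R].

(* The linear extension of [act_tabloid s]. *)
Definition act_tabmod (s : 'S_n) (v : tabmod) : tabmod :=
  [ffun g => v (act_tabloid s^-1%g g)].

Definition polytabloid (t : tableau n) : tabmod :=
  \sum_(tau in col_stab t) (-1) ^+ tau *: tabvec (act_tabloid tau (tabloid_of t)).

(* The bijective fillings of rho are [reshape rho (codom s)] for s in 'S_n.   *)
Definition specht (rho : seq nat) : {vspace tabmod} :=
  <<[seq polytabloid (reshape rho (codom s)) | s : 'S_n]>>%VS.

(* The classes modulo J of the (F i), i in P, span a copy of V_rho: there is  *)
(* a linear map phi to polynomials whose composite with the projection modulo *)
(* J is, on V_rho, equivariant and injective, with image that span.           *)
Definition spans_specht (J : {mpoly rat[n]} -> Prop) (rho : seq nat)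
    (I : eqType) (P : pred I) (F : I -> {mpoly rat[n]}) : Prop :=
  exists phi : {linear tabmod -> {mpoly rat[n]}},
    [/\ forall (s : 'S_n) v, v \in specht rho ->
          J (phi (act_tabmod s v) - msym s (phi v)),
        forall v, v \in specht rho -> J (phi v) -> v = 0,
        forall v, v \in specht rho -> in_span_mod J P F (phi v)
      & forall i, P i -> exists2 v, v \in specht rho & J (F i - phi v)].

End Specht.

Definition higher_specht_basis (n : nat) (la : seq nat) (s : nat) : Prop :=
  basis_mod (@I_ideal n la s) (@C_index n la s) (@C_elt n la) /\
  forall (S : tableau n) (mu : seq nat), Sigma la s (S, mu) ->
    spans_specht (@I_ideal n la s) (shape S)
      (fun T => C_index la s ((S, mu), T)) (fun T => C_elt la ((S, mu), T)).

(* Main.v *)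
(* Modulo the squares x_i^2, which lie in the ideal since s <= 2, a polynomial is a     *)
(* function on the subsets of {1, .., n}, and multiplication by e_1 and D, the sum of   *)
(* the d/dx_i, are adjoint operators that generate an action of sl_2.  So the degree d  *)
(* part is the sum of the e_1^(d-r) H_r with r <= min(d, n-d), where H_r, the kernel of *)
(* D in degree r, is a copy of V_(n-r,r).  For la = (a, b) the ideal consists of the    *)
(* multiples of e_1^(n-a-b+1) and of everything in degrees above n-a, so e_1^(d-r) H_r  *)
(* survives in the quotient exactly when d <= n-a and d-r <= n-a-b.  (If la has at most  *)
(* one row, the quotient is 0 or Q.)                                                    *)
(*                                                                                      *)
(* A tableau S with at most one descent is determined by its shape (n-r,r) and by the   *)
(* degree d of its cocharge monomial, and the condition on ctype is then that d <= n-a  *)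
(* and d-r <= n-a-b.  Modulo squares, F_T^S is a nonzero multiple of e_1^(d-r) times    *)
(* the Specht polynomial of T (and e_m is e_1^m / m! when S is a single row).  Finally  *)
(* the Specht polynomials of standard T form a basis of H_r: their leading monomials    *)
(* are the second rows of the T, which are the ballot sets, and the leading monomial of *)
(* any element of H_r is a ballot set because D is injective in degrees above half the  *)
(* number of variables.                                                                 *)

Require Import Defs.
From HB Require Import structures.
From mathcomp Require Import all_boot all_order all_fingroup all_algebra.
From mathcomp Require Import zify ring.

Set Implicit Arguments.
Unset Strict Implicit.
Unset Printing Implicit Defensive.

Import Order.TTheory GRing.Theory Num.Theory.

Local Open Scope ring_scope.

(** * Functions on subsets *)

(** For nonempty la one has s <= 2, so the ideal contains every monomial with a square factor and is
    the preimage of a subspace of the functions on subsets ([ideal2E], [ideal1E]). On these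
    functions U, multiplication by e_1, and D are adjoint for a positive definite form ([dot_up])
    and satisfy the sl_2 relation [down_up]. Hence every function is a sum of pieces U^(d-r) H_r
    ([hom_decomp]), with H_r the kernel of D in degree r, and these pieces are independent
    ([iter_up_free]). [adapted] says which pairs (r, d) die in the quotient and that the others stay
    independent there; [adapted2] and [adapted1] prove it for two rows and for one row.

    On the combinatorial side, the second row of a standard tableau with at most one descent is an
    interval ([syt_low_des]). Running the catabolism on its reading word turns the dominance
    condition into two inequalities ([dominates_ctype2]), so [Sigma] has exactly one pair for each
    surviving (r, d) ([SigmaE2], [SigmaE1]).

    The two sides meet in [sfpart_F_poly]: row symmetrization turns the cocharge monomial into a
    multiple of U^(d-r) applied to the monomial of the second row of T, and column
    antisymmetrization turns that monomial into the Specht polynomial of T. For standard T the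
    Specht polynomials have distinct leading sets ([polytab_lead]), and only ballot sets can lead an
    element of H_r ([ker_down_lead_ballot]), so they form a basis of H_r. [span_modC], [free_modC]
    and [spans_specht_C] assemble the theorem. For empty la the ideal is everything and [Sigma] is
    empty. *)

Section SubsetFunctions.
Variable n : nat.
Implicit Types (A M : {set 'I_n}) (d r j : nat).

(* [v A] is the coefficient of the squarefree monomial prod_(i in A) x_i; modulo the    *)
(* squares x_i^2, [up M] is multiplication by sum_(i in M) x_i and [down M] is the sum  *)
(* of the partial derivatives d/dx_i for i in M.                                        *)
Definition sqfree : Type := {ffun {set 'I_n} -> rat^o}.
HB.instance Definition _ := Vector.on sqfree.
Implicit Types u v w h : sqfree.

Definition up M v : sqfree := [ffun A => \sum_(i in A :&: M) v (A :\ i)].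
Definition down M v : sqfree := [ffun A => \sum_(i in M :\: A) v (i |: A)].

Fact up_linear M : linear (up M).
Proof.
move=> c u v; apply/ffunP=> A; rewrite !ffunE scaler_sumr -big_split /=.
by apply: eq_bigr => i _; rewrite !ffunE.
Qed.
HB.instance Definition _ M :=
  GRing.isLinear.Build rat sqfree sqfree _ (up M) (up_linear M).

Fact down_linear M : linear (down M).
Proof.
move=> c u v; apply/ffunP=> A; rewrite !ffunE scaler_sumr -big_split /=.
by apply: eq_bigr => i _; rewrite !ffunE.
Qed.
HB.instance Definition _ M :=
  GRing.isLinear.Build rat sqfree sqfree _ (down M) (down_linear M).

Definition dot u v : rat := \sum_A (u A : rat) * v A.

Lemma dotC u v : dot u v = dot v u.
Proof. by apply: eq_bigr => A _; rewrite mulrC. Qed.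

Lemma dotZr c u v : dot u (c *: v) = c * dot u v.
Proof.
by rewrite /dot mulr_sumr; apply: eq_bigr => A _; rewrite ffunE /= mulrCA.
Qed.

Lemma dot0r u : dot u 0 = 0.
Proof. by rewrite -(scale0r 0) dotZr mul0r. Qed.

Lemma dotvv_eq0 v : dot v v = 0 -> v = 0.
Proof.
move=> /psumr_eq0P vv0; apply/ffunP=> A; rewrite ffunE.
have /eqP := vv0 (fun A _ => sqr_ge0 (v A : rat)) A isT.
by rewrite mulf_eq0 orbb => /eqP.
Qed.

(** Both sides sum u (A :\ i) * v A over the pairs with i in A and in M. *)
Lemma dot_up M u v : dot (up M u) v = dot u (down M v).
Proof.
rewrite /dot.
under eq_bigr do rewrite ffunE mulr_suml.
under [RHS]eq_bigr do rewrite ffunE mulr_sumr.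
rewrite (exchange_big_dep [in M]) => [|A i _] /=; last by rewrite inE => /andP[].
rewrite [RHS](exchange_big_dep [in M]) => [|A i _] /=; last by rewrite inE => /andP[].
apply: eq_bigr => i iM.
rewrite (reindex_onto (fun A => i |: A) (fun A => A :\ i)) /= => [|A]; last first.
  by rewrite inE => /andP[iA _]; rewrite setD1K.
apply: eq_big => [A | A]; last by case/andP=> _ /eqP->.
rewrite !inE eqxx iM !andbT; apply/eqP/idP => [<- | iNA]; first by rewrite !inE eqxx.
by rewrite setU1K.
Qed.

(** The terms that exchange an element of A for one outside occur in both products and cancel. The
    terms that return to A number |M \ A| in the first product and |A :&: M| in the second. *)
Lemma down_up M v A :
  down M (up M v) A - up M (down M v) A = (#|M|%:R - 2 * #|A :&: M|%:R) * v A.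
Proof.
have -> : down M (up M v) A = \sum_(i in M :\: A)
    (v A + \sum_(j in A :&: M) v ((i |: A) :\ j)).
  rewrite ffunE; apply: eq_bigr => i; rewrite inE => /andP[iNA iM].
  rewrite ffunE (bigD1 i) /=; last by rewrite !inE eqxx.
  rewrite setU1K //; congr (_ + _); apply: eq_bigl => j.
  by rewrite !inE; case: eqVneq => [->|_]; rewrite ?andbF ?(negPf iNA) // andbT.
have -> : up M (down M v) A = \sum_(j in A :&: M)
    (v A + \sum_(i in M :\: A) v ((i |: A) :\ j)).
  rewrite ffunE; apply: eq_bigr => j; rewrite inE => /andP[jA jM].
  rewrite ffunE (bigD1 j) /=; last by rewrite !inE eqxx.
  rewrite setD1K //; congr (_ + _); apply: eq_big => [i|i].
    by rewrite !inE; case: eqVneq => [->|_]; rewrite ?andbF ?jA // andbT.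
  rewrite !inE negb_and negbK => /andP[/andP[/orP[/eqP->|iNA] iM] neq_ij].
    by rewrite eqxx in neq_ij.
  congr (v _); apply/setP=> x; rewrite !inE.
  by case: (eqVneq x i) => [->|_]; rewrite ?neq_ij.
rewrite !big_split /= !sumr_const exchange_big /= opprD addrACA subrr addr0.
have -> : #|M|%:R = #|M :\: A|%:R + #|A :&: M|%:R :> rat.
  by rewrite -natrD addnC setIC cardsID.
rewrite -[v A *+ _](@mulr_natl rat) -[v A *+ #|A :&: M|](@mulr_natl rat).
by rewrite -(@mulrBl rat); congr (_ * _); ring.
Qed.

(** On such v the commutator of [down_up] is a negative scalar, so [down M v = 0] makes the squared
    norm of [up M v] a negative multiple of that of v. *)
Lemma down_inj M j v :
    (#|M| < 2 * j)%N -> (forall A, v A != 0 -> #|A :&: M| = j) ->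
  down M v = 0 -> v = 0.
Proof.
move=> ltMj supp Dv0; apply: dotvv_eq0.
have DUv : down M (up M v) = (#|M|%:R - 2 * j%:R) *: v.
  apply/ffunP=> A; have := down_up M v A; rewrite Dv0 linear0 !ffunE subr0 => ->.
  have [-> | /supp ->//] := eqVneq (v A) 0; by rewrite mulr0 scaler0.
have neg : #|M|%:R - 2 * j%:R < 0 :> rat by rewrite subr_lt0 -natrM ltr_nat.
have sq_ge0 u : 0 <= dot u u by apply: sumr_ge0 => A _; apply: sqr_ge0.
have /eqP := dot_up M v (up M v); rewrite DUv dotZr => /eqP eqUv.
have := sq_ge0 (up M v); rewrite eqUv nmulr_rge0 // => vv_le0.
by apply/eqP; rewrite eq_le vv_le0 sq_ge0.
Qed.

Local Notation U := (up setT).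
Local Notation D := (down setT).

Lemma up_down_cap0 u : D (U u) = 0 -> U u = 0.
Proof. by move=> DU; apply: dotvv_eq0; rewrite dot_up DU dot0r. Qed.

Lemma down_up_cap0 u : U (D u) = 0 -> D u = 0.
Proof. by move=> UD; apply: dotvv_eq0; rewrite -dot_up UD dotC dot0r. Qed.

(** By adjointness im U meets ker D in 0 and im D meets ker U in 0. So D is injective on im U and U
    on im D, the two images have the same dimension, and im U + ker D fills the space. *)
Lemma im_up_ker_down v : exists w h, v = U w + h /\ D h = 0.
Proof.
pose f : 'Hom(sqfree, sqfree) := linfun U; pose g : 'Hom(sqfree, sqfree) := linfun D.
have capfg : (limg f :&: lker g)%VS = 0%VS.
  apply/eqP; rewrite -subv0; apply/subvP=> x /memv_capP[/memv_imgP[y _ ->]].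
  by rewrite memv_ker memv0 /f /g !lfunE => /eqP/up_down_cap0 /eqP.
have capgf : (limg g :&: lker f)%VS = 0%VS.
  apply/eqP; rewrite -subv0; apply/subvP=> x /memv_capP[/memv_imgP[y _ ->]].
  by rewrite memv_ker memv0 /f /g !lfunE => /eqP/down_up_cap0 /eqP.
have le_fg : (\dim (limg f) <= \dim (limg g))%N.
  by rewrite -(limg_ker_dim g (limg f)) capfg dimv0 dimvS ?limgS ?subvf.
have le_gf : (\dim (limg g) <= \dim (limg f))%N.
  by rewrite -(limg_ker_dim f (limg g)) capgf dimv0 dimvS ?limgS ?subvf.
have full : (limg f + lker g)%VS = fullv.
  apply/eqP; rewrite eqEdim subvf dimv_disjoint_sum //.
  rewrite -(limg_ker_dim g fullv) capfv.
  by rewrite /= [X in (X <= _)%N]addnC leq_add2r.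
have /memv_addP[x /memv_imgP[w _ ->] [h hk eq_v]] : v \in (limg f + lker g)%VS.
  by rewrite full memvf.
exists w, h; split; first by rewrite eq_v /f lfunE.
by move: hk; rewrite memv_ker /g lfunE => /eqP.
Qed.

Definition homdeg d v : Prop := forall A, v A != 0 -> #|A| = d.

Definition proj d v : sqfree := [ffun A : {set 'I_n} => if #|A| == d then v A else 0].

Fact proj_linear d : linear (proj d).
Proof.
move=> c u v; apply/ffunP=> A; rewrite !ffunE.
by case: ifP => // _; rewrite scaler0 addr0.
Qed.
HB.instance Definition _ d :=
  GRing.isLinear.Build rat sqfree sqfree _ (proj d) (proj_linear d).

Lemma hom_proj d v : homdeg d (proj d v).
Proof. by move=> A; rewrite ffunE; case: ifP => [/eqP //|]; rewrite eqxx. Qed.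

Lemma proj_hom d v : homdeg d v -> proj d v = v.
Proof.
move=> hv; apply/ffunP=> A; rewrite ffunE; case: eqVneq => // neq_d.
by apply/esym/eqP/contraT => /hv /eqP; rewrite (negPf neq_d).
Qed.

Lemma proj_hom0 d e v : homdeg e v -> e != d -> proj d v = 0.
Proof.
move=> hv ned; apply/ffunP=> A; rewrite !ffunE; case: eqP => // eqd.
by apply/eqP/contraT => /hv eqe; rewrite -eqe eqd eqxx in ned.
Qed.

Lemma sum_proj v : v = \sum_(d < n.+1) proj d v.
Proof.
apply/ffunP=> A; rewrite sum_ffunE.
have ltA : (#|A| < n.+1)%N by rewrite ltnS -[X in (_ <= X)%N]card_ord max_card.
rewrite (bigD1 (Ordinal ltA)) //= ffunE eqxx big1 ?addr0 // => d ned.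
by rewrite ffunE; case: eqP => // eqd; case/eqP: ned; apply/val_inj.
Qed.

Lemma proj_up d v : proj d.+1 (U v) = U (proj d v).
Proof.
apply/ffunP=> A; rewrite !ffunE setIT; case: eqP => eqd.
  apply: eq_bigr => i iA; rewrite ffunE -eqSS -eqd.
  by rewrite (cardsD1 i A) iA add1n eqxx.
rewrite big1 // => i iA; rewrite ffunE; case: eqP => // eqd'; case: eqd.
by rewrite (cardsD1 i A) iA eqd'.
Qed.

Lemma proj_up0 v : proj 0 (U v) = 0.
Proof.
apply/ffunP=> A; rewrite !ffunE; case: eqP => // /eqP.
by rewrite cards_eq0 => /eqP ->; rewrite set0I big_set0.
Qed.

Lemma down_proj d v : D (proj d.+1 v) = proj d (D v).
Proof.
apply/ffunP=> A; rewrite !ffunE; case: eqP => eqd.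
  by apply: eq_bigr => i /setDP[_ iA]; rewrite ffunE cardsU1 iA eqd eqxx.
rewrite big1 // => i /setDP[_ iA]; rewrite ffunE; case: eqP => // eqd'; case: eqd.
by move: eqd'; rewrite cardsU1 iA add1n => -[].
Qed.

Lemma down_proj0 v : D (proj 0 v) = 0.
Proof.
apply/ffunP=> A; rewrite !ffunE big1 // => i _; rewrite ffunE; case: eqP => //.
by move/eqP; rewrite cards_eq0 => /eqP/setP/(_ i); rewrite !inE eqxx.
Qed.

Lemma iter_lin0 (f : {linear sqfree -> sqfree}) m : iter m f 0 = 0.
Proof. by elim: m => //= m ->; rewrite linear0. Qed.

Lemma iter_linD (f : {linear sqfree -> sqfree}) m u v :
  iter m f (u + v) = iter m f u + iter m f v.
Proof. by elim: m => //= m ->; rewrite linearD. Qed.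

Lemma iter_linZ (f : {linear sqfree -> sqfree}) m c v :
  iter m f (c *: v) = c *: iter m f v.
Proof. by elim: m => //= m ->; rewrite linearZ. Qed.

Lemma iter_lin_sum (f : {linear sqfree -> sqfree}) m (I : Type) (s : seq I)
    (P : pred I) (F : I -> sqfree) :
  iter m f (\sum_(i <- s | P i) F i) = \sum_(i <- s | P i) iter m f (F i).
Proof. by elim: m => //= m ->; rewrite linear_sum. Qed.

Lemma hom_up d v : homdeg d v -> homdeg d.+1 (U v).
Proof. by move/proj_hom <-; rewrite -proj_up; apply: hom_proj. Qed.

Lemma hom_iter_up d j v : homdeg d v -> homdeg (d + j) (iter j U v).
Proof. by move=> hv; elim: j => [|j IHj]; rewrite ?addn0 // addnS; apply: hom_up. Qed.

Lemma hom_decomp d v (X : sqfree -> Prop) :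
    X 0 -> (forall u w, X u -> X w -> X (u + w)) ->
    (forall r j h, (r + j = d)%N -> homdeg r h -> D h = 0 -> X (iter j U h)) ->
  homdeg d v -> X v.
Proof.
elim: d v X => [|d IHd] v X X0 XD XU hv.
  by apply: (XU 0%N 0%N) => //; rewrite -(proj_hom hv) down_proj0.
have [w [h [eq_v Dh0]]] := im_up_ker_down v.
rewrite -(proj_hom hv) eq_v linearD /= proj_up; apply: (XD); last first.
  apply: (XU d.+1 0%N); rewrite ?addn0 //; first exact: hom_proj.
  by rewrite down_proj Dh0 linear0.
(* The induction hypothesis, taken for the property [X (U u)] of u, absorbs the extra factor U. *)
apply: (IHd (proj d w) (fun u => X (U u))); last exact: hom_proj.
- by rewrite linear0.
- by move=> u1 u2; rewrite linearD; apply: XD.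
- by move=> r j h' eq_d hh' Dh'; rewrite -iterS; apply: (XU r j.+1) => //; rewrite addnS eq_d.
Qed.

Lemma down_up_hom d v : homdeg d v -> D (U v) = U (D v) + (n%:R - 2 * d%:R) *: v.
Proof.
move=> hv; apply/ffunP=> A; have /eqP := down_up setT v A.
rewrite subr_eq cardsT card_ord setIT => /eqP ->.
rewrite !ffunE addrC; congr (_ + _).
have [-> | /hv ->//] := eqVneq (v A) 0; by rewrite mulr0 scaler0.
Qed.

Lemma down_iter_up r h j : homdeg r h -> D h = 0 ->
  D (iter j.+1 U h) = (j.+1%:R * (n%:R - 2 * r%:R - j%:R)) *: iter j U h.
Proof.
move=> hh Dh0; elim: j => [|j IHj].
  by rewrite /= (down_up_hom hh) Dh0 linear0 add0r mul1r subr0.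
rewrite iterS (down_up_hom (hom_iter_up (j := j.+1) hh)) IHj linearZ /= -scalerDl.
by congr (_ *: _); rewrite natrD; ring.
Qed.

(** The coefficient in [down_iter_up] vanishes at n - 2r, so D kills U^(n-2r+1) h, and an element of
    im U in ker D is 0. If 2r > n, then h itself is 0 by [down_inj]. *)
Lemma iter_up_ker_eq0 r h j : homdeg r h -> D h = 0 -> (n < r + r + j)%N ->
  iter j U h = 0.
Proof.
move=> hh Dh0 ltn; have [r_le | r_gt] := leqP (r + r) n; last first.
  have -> : h = 0.
    apply: (@down_inj setT r) => // [|A hA]; first by rewrite cardsT card_ord mul2n -addnn.
    by rewrite setIT; apply: hh.
  exact: iter_lin0.
pose j0 := (n - (r + r))%N.
have U0 : iter j0.+1 U h = 0.
  apply: up_down_cap0; rewrite -iterS (down_iter_up _ hh Dh0).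
  have -> : n%:R = r%:R + r%:R + j0%:R :> rat by rewrite -!natrD subnKC.
  by rewrite (_ : _ - _ = 0) ?mulr0 ?scale0r //; ring.
have /subnK <- : (j0.+1 <= j)%N by rewrite /j0; lia.
by rewrite iterD U0 iter_lin0.
Qed.

Lemma iter_down_up0 r h i j : homdeg r h -> D h = 0 -> (i < j)%N ->
  iter j D (iter i U h) = 0.
Proof.
move=> hh Dh0; elim: i j => [|i IHi] [|j] // ltij; rewrite iterSr.
  by rewrite Dh0 iter_lin0.
by rewrite (down_iter_up _ hh Dh0) iter_linZ IHi ?scaler0.
Qed.

(** In this range the coefficients of [down_iter_up] are nonzero, so D undoes each U up to a
    scalar. *)
Lemma iter_up_inj r h j : homdeg r h -> D h = 0 -> (r + r + j <= n)%N ->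
  iter j U h = 0 -> h = 0.
Proof.
move=> hh Dh0; elim: j => // j IHj lejn U0.
apply: IHj; first by lia.
have := down_iter_up j hh Dh0; rewrite U0 linear0 => /esym/eqP.
rewrite scaler_eq0 mulf_eq0 pnatr_eq0 /= => /orP[|/eqP//].
rewrite -natrM -!natrB //; last by lia.
  by rewrite pnatr_eq0; lia.
by lia.
Qed.

(** Strong induction on r: D^(d-r) kills the terms of larger index, and those of smaller index are
    already 0. *)
Lemma iter_up_free (h : nat -> sqfree) d :
    (forall r, (r <= d)%N -> [/\ homdeg r (h r), D (h r) = 0 & h r != 0 -> (d + r <= n)%N]) ->
    \sum_(r < d.+1) iter (d - r) U (h r) = 0 ->
  forall r, (r <= d)%N -> h r = 0.
Proof.
move=> hP sum0 r; elim/ltn_ind: r => r IHr le_rd.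
have [hr Dr lr] := hP r le_rd.
apply/eqP; apply: contraT => hr_n0; case/eqP: (hr_n0).
apply: (iter_up_inj (j := d - r) hr Dr); first by have := lr hr_n0; lia.
have ltr : (r < d.+1)%N by [].
have := congr1 (iter (d - r) D) sum0.
rewrite iter_lin0 iter_lin_sum (bigD1 (Ordinal ltr)) //= big1 ?addr0 => [DU0|i nei]; last first.
  have [hi Di _] := hP i (ltn_ord i).
  have [lt_ir|] := ltnP i r.
    by rewrite IHr ?leq_ord // !iter_lin0.
  rewrite leq_eqVlt => /orP[/eqP eq_ri | lt_ri].
    by case/eqP: nei; apply/val_inj.
  by apply: iter_down_up0 hi Di _; have := ltn_ord i; lia.
(* From D^j U^j h_r = 0 to U^j h_r = 0: each D yields a scalar, and when that scalar is 0 one has n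
   = 2r + j, so that the next power of U already kills h_r. *)
elim: (d - r)%N DU0 => // j IHj.
rewrite iterSr (down_iter_up _ hr Dr).
rewrite iter_linZ => /eqP; rewrite scaler_eq0 => /orP[|/eqP /IHj Uj0]; last first.
  by rewrite iterS Uj0 linear0.
rewrite mulf_eq0 pnatr_eq0 /= subr_eq0 => /eqP eqj.
apply: (iter_up_ker_eq0 (j := j.+1) hr Dr).
have : n%:R = (r + r + j)%:R :> rat by rewrite !natrD -eqj; ring.
by move/eqP; rewrite eqr_nat => /eqP->; rewrite addnS.
Qed.

(* [iter m U] and [iter m D] are adjoint, so v is orthogonal to itself. *)
Lemma iter_up_im_eq0 m v w :
  iter m D v = 0 -> v = iter m U w -> v = 0.
Proof.
move=> Dv0 eq_v; apply: dotvv_eq0; rewrite {1}eq_v.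
have -> : dot (iter m U w) v = dot w (iter m D v).
  by elim: m v {Dv0 eq_v} => //= m IHm v; rewrite dot_up IHm -iterSr.
by rewrite Dv0 dot0r.
Qed.

(* Orders sets by the largest element at which they differ. *)
Definition weight A : nat := \sum_(i in A) 2 ^ i.

(** The condition for A to be the second row of a standard tableau; see [ballot_syt]. *)
Definition ballot A : Prop := forall m : nat,
  (#|[set i in A | i < m]| <= #|[set i in ~: A | i < m]|)%N.

Lemma weight_lt A (m : nat) : (forall i, i \in A -> (i < m)%N) -> (weight A < 2 ^ m)%N.
Proof.
elim: m A => [|m IHm] A ltA.
  by rewrite /weight big1 // => i /ltA.
have [/existsP[i /andP[iA /eqP im]]|] := boolP [exists i in A, (i == m :> nat)].
  have : (weight (A :\ i) < 2 ^ m)%N.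
    apply: IHm => j; rewrite !inE => /andP[ne_ji /ltA].
    by rewrite ltnS leq_eqVlt -im val_eqE (negPf ne_ji).
  rewrite expnS mul2n -addnn {2}/weight (big_setD1 i) //= im -/(weight _).
  by rewrite ltn_add2l.
rewrite negb_exists => /forallP noti.
apply: (leq_trans (IHm A _)); last by rewrite leq_exp2l.
move=> i iA; have := ltA i iA; rewrite ltnS leq_eqVlt => /orP[im|//].
by have := noti i; rewrite iA im.
Qed.

(** Uniqueness of binary expansions, comparing the bits from the top. *)
Lemma weight_inj : injective weight.
Proof.
move=> A B eqw; apply/setP.
suff main (m : nat) (A1 B1 : {set 'I_n}) :
   (forall i : 'I_n, (m <= i)%N -> (i \in A1) = (i \in B1)) ->
   weight A1 = weight B1 -> A1 =i B1.
  by apply: (main n) => // i; rewrite leqNgt ltn_ord.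
elim: m A1 B1 => [|m IHm] A1 B1 eqAB eqw1; first by move=> i; apply: eqAB.
apply: IHm => // i le_mi; move: le_mi; rewrite leq_eqVlt => /orP[/eqP mi|]; last exact: eqAB.
wlog: A1 B1 eqAB eqw1 / (i \in A1) && (i \notin B1).
  move=> wlog_; case iA: (i \in A1); case iB: (i \in B1) => //.
    by rewrite -iA -iB; apply: wlog_; rewrite ?iA ?iB.
  by rewrite -iA -iB; apply/esym/wlog_; rewrite ?iA ?iB // => j /eqAB.
case/andP=> iA iNB; exfalso.
have wE (E : {set 'I_n}) : weight E =
    (\sum_(j in E | (m < j)%N) 2 ^ j + weight [set j in E | (j <= m)%N])%N.
  rewrite /weight (bigID (fun j : 'I_n => (m < j)%N)) /=; congr (_ + _)%N.
  by apply: eq_bigl => j; rewrite inE -leqNgt.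
move: eqw1; rewrite (wE A1) (wE B1).
rewrite (eq_bigl (fun j : 'I_n => (j \in B1) && (m < j)%N)) => [/addnI eqw1|j]; last first.
  by case: ltnP => [/eqAB->//|]; rewrite ?andbF.
have : (weight [set j in B1 | (j <= m)%N] < 2 ^ m)%N.
  apply: weight_lt => j; rewrite inE leq_eqVlt => /andP[jB /orP[/eqP jm|//]].
  by case/negP: iNB; rewrite (_ : i = j) //; apply/val_inj; rewrite /= -mi jm.
rewrite -eqw1 /weight (bigD1 i) /=; last by rewrite inE iA mi leqnn.
by rewrite -mi ltnNge leq_addr.
Qed.

(* If A fails the ballot condition at m, the terms of h that agree with A above m form *)
(* an element of ker (down {0, .., m-1}), which is 0 by [down_inj].                    *)
Lemma ker_down_lead_ballot h A : D h = 0 -> h A != 0 ->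
  (forall B, h B != 0 -> (weight B <= weight A)%N) -> ballot A.
Proof.
move=> Dh0 hA maxA m; rewrite leqNgt; apply/negP => ltm.
pose M : {set 'I_n} := [set i : 'I_n | (i < m)%N].
pose C := A :\: M.
pose v : sqfree := [ffun B : {set 'I_n} =>
  if (B :\: M == C) && (#|B :&: M| == #|A :&: M|) then h B else 0].
have setE (E : {set 'I_n}) : [set i in E | (i < m)%N] = E :&: M.
  by apply/setP=> i; rewrite !inE.
suff v0 : v = 0.
  move: hA; have := congr1 (fun f : sqfree => f A) v0.
  by rewrite !ffunE !eqxx /= => ->; rewrite eqxx.
apply: (@down_inj M #|A :&: M|).
- move: ltm; rewrite !setE -(cardsID A M) (setIC M) (_ : M :\: A = ~: A :&: M)
    ?mul2n -?addnn ?ltn_add2l //.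
  by rewrite setDE setIC.
- by move=> B; rewrite ffunE; case: ifP => [/andP[_ /eqP]//|]; rewrite eqxx.
apply/ffunP=> B; rewrite !ffunE.
have [/andP[/eqP eqC /eqP cardB] | nB] :=
  boolP ((B :\: M == C) && (#|B :&: M|.+1 == #|A :&: M|)); last first.
  (* If B does not have the right trace inside and outside M, adding an element of M never reaches
     the support of [v]. *)
  apply: big1 => i; rewrite inE => /andP[iNB iM]; rewrite ffunE.
  case: ifP => // /andP[/eqP eqC /eqP cardC]; case/negP: nB; rewrite -cardC.
  rewrite (_ : (i |: B) :&: M = i |: (B :&: M)); last first.
    by apply/setP=> j; rewrite !inE; case: eqVneq => [->|] //=; move: iM; rewrite inE => ->.
  rewrite cardsU1 inE (negPf iNB) eqxx andbT -eqC; apply/eqP/setP=> j; rewrite !inE.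
  by case: eqVneq => [->|] //=; move: iM; rewrite inE => ->.
(* Otherwise the sum is the part of [D h] at B with i in M; the remaining part is shown to
   vanish. *)
have := congr1 (fun f : sqfree => f B) Dh0; rewrite !ffunE.
rewrite (bigID [in M]) /= [X in _ + X]big1 ?addr0 => [E0|i].
  rewrite -[RHS]E0; apply: eq_big => [i|i]; first by rewrite !inE andbT.
  rewrite inE => /andP[iNB iM]; rewrite ffunE ifT //.
  rewrite (_ : (i |: B) :&: M = i |: (B :&: M)); last first.
    by apply/setP=> j; rewrite !inE; case: eqVneq => [->|] //=; move: iM; rewrite inE => ->.
  rewrite cardsU1 inE (negPf iNB) add1n cardB eqxx andbT -eqC; apply/eqP/setP=> j; rewrite !inE.
  by case: eqVneq => [->|] //=; move: iM; rewrite inE => ->.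
rewrite !inE andbT => /andP[iNB iNM].
(* As i >= m, adding it to B contributes at least 2^m, more than all of A below m; the result
   outweighs A, so h vanishes on it. *)
apply/eqP; apply: contraT => /maxA; rewrite leqNgt => /negP[].
have wE (E : {set 'I_n}) : weight E = (weight (E :\: M) + weight (E :&: M))%N.
  rewrite /weight (bigID [in M]) addnC /=; congr (_ + _)%N; apply: eq_bigl => j;
    by rewrite !inE // andbC.
have : (weight (A :&: M) < 2 ^ m)%N by apply: weight_lt => j; rewrite !inE => /andP[].
rewrite [weight A]wE -/C -eqC => ltAm.
rewrite /weight big_setU1 //= -/(weight B) (wE B).
have : (2 ^ m <= 2 ^ i)%N by rewrite leq_exp2l // leqNgt.
by rewrite -/(weight (B :\: M)) -/(weight (A :&: M)); lia.
Qed.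

(** Triangular reduction: the leading set A of h is ballot, and subtracting [h A *: P A] lowers the
    leading weight. *)
Lemma ker_down_span (P : {set 'I_n} -> sqfree) r (X : sqfree -> Prop) h :
    (forall A, ballot A -> #|A| = r ->
      [/\ homdeg r (P A), D (P A) = 0, P A A = 1
        & forall B, P A B != 0 -> (weight B <= weight A)%N]) ->
    X 0 -> (forall u v, X u -> X v -> X (u + v)) ->
    (forall c A, ballot A -> #|A| = r -> X (c *: P A)) ->
  homdeg r h -> D h = 0 -> X h.
Proof.
move=> PP X0 XD XP.
have [N] : exists N, forall A, (h A != 0) -> (weight A < N)%N.
  exists (2 ^ n)%N => A _; exact: weight_lt.
elim: N h => [|N IHN] h ltN hh Dh0.
  suff -> : h = 0 by [].
  by apply/ffunP=> A; rewrite ffunE; apply/eqP; apply: contraT => /ltN.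
have [/existsP[A /andP[hA /eqP wA]] | noA] := boolP [exists A, (h A != 0) && (weight A == N)].
  have cardA := hh A hA.
  have balA : ballot A by apply: ker_down_lead_ballot Dh0 hA _ => B /ltN; rewrite wA.
  have [hP DP PA maxP] := PP A balA cardA.
  rewrite -[h](subrK ((h A : rat) *: P A)); apply: (XD); last exact: XP.
  apply: IHN; last by rewrite linearB linearZ /= DP Dh0 scaler0 subr0.
    move=> B; rewrite !ffunE => hB.
    have : (weight B <= N)%N.
      move: hB; apply: contraR; rewrite -ltnNge => ltNB.
      have -> : h B = 0 by apply/eqP; apply: contraT => /ltN; rewrite ltnS leqNgt ltNB.
      have -> : P A B = 0.
        by apply/eqP; apply: contraT => /maxP; rewrite wA leqNgt ltNB.
      by rewrite scaler0 subr0.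
    rewrite leq_eqVlt => /orP[/eqP wB|//].
    have eqAB : A = B by apply: weight_inj; rewrite wA wB.
    by move: hB; rewrite -eqAB PA /GRing.scale /= mulr1 subrr eqxx.
  move=> B; rewrite !ffunE; have [-> | /hh//] := eqVneq (h B) 0.
  by rewrite add0r oppr_eq0 scaler_eq0 negb_or => /andP[_ /hP].
apply: IHN => // A hA; have := ltN A hA; rewrite ltnS leq_eqVlt => /orP[wA|//].
by case/existsP: noA; exists A; rewrite hA.
Qed.

End SubsetFunctions.

(** * Squarefree parts of polynomials *)

Section SquarefreePart.
Variable n : nat.
Implicit Types (A B C M Q : {set 'I_n}) (p q : {mpoly rat[n]}) (v w : sqfree n).
Local Notation U := (@up n setT).

Definition mnm_set A : 'X_{1..n} := [multinom (i \in A : nat) | i < n].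

(** The quotient map modulo the squares of the variables; [sflift] is a section of it. *)
Definition sfpart p : sqfree n := [ffun A => p@_(mnm_set A)].

Fact sfpart_linear : linear sfpart.
Proof. by move=> c p q; apply/ffunP=> A; rewrite !ffunE mcoeffD mcoeffZ. Qed.
HB.instance Definition _ :=
  GRing.isLinear.Build rat {mpoly rat[n]} (sqfree n) _ sfpart sfpart_linear.

Definition delta Q : sqfree n := [ffun A => (A == Q)%:R].

Definition linform M : {mpoly rat[n]} := \sum_(i in M) 'X_i.

Definition mulX i v : sqfree n := [ffun A : {set 'I_n} => if i \in A then v (A :\ i) else 0].

Definition sflift v : {mpoly rat[n]} := \sum_A (v A : rat) *: 'X_[mnm_set A].

Lemma mnm_set_inj : injective mnm_set.
Proof.
move=> A B /mnmP eqAB; apply/setP=> i; have := eqAB i; rewrite !mnmE.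
by do 2!case: (i \in _).
Qed.

Lemma mnm_setE (m : 'X_{1..n}) :
  (forall i, m i <= 1)%N -> m = mnm_set [set i | m i != 0%N].
Proof.
by move=> le1; apply/mnmP=> i; rewrite mnmE inE; case: (m i) (le1 i) => [|[|]].
Qed.

Lemma sfpartX A : sfpart 'X_[mnm_set A] = delta A.
Proof.
by apply/ffunP=> B; rewrite !ffunE mcoeffX eq_sym (inj_eq mnm_set_inj).
Qed.

Lemma sfpart1 : sfpart 1 = delta set0.
Proof.
rewrite -sfpartX (_ : mnm_set set0 = 0%MM) ?mpolyX0 //.
by apply/mnmP=> i; rewrite mnmE mnm0E inE.
Qed.

Lemma sfliftK v : sfpart (sflift v) = v.
Proof.
apply/ffunP=> A; rewrite linear_sum sum_ffunE (bigD1 A) //= big1 => [|B neBA].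
  by rewrite linearZ /= sfpartX !ffunE eqxx [_ *: _]mulr1 addr0.
by rewrite linearZ /= sfpartX !ffunE eq_sym (negPf neBA) scaler0.
Qed.

(** A squarefree monomial factors only into monomials on subsets of its support. Taken with all
    sets, this makes multiplication well defined on squarefree parts; taken with small sets, it
    shows that the functions vanishing on them form an ideal. *)
Lemma sfpartM0 p q (X : pred {set 'I_n}) :
    (forall A B, A \subset B -> X B -> X A) ->
    (forall A, X A -> sfpart p A = 0) ->
  forall A, X A -> sfpart (p * q) A = 0.
Proof.
move=> Xsub p0 A XA; rewrite ffunE mcoeffM big1 // => -[k1 k2] /= /eqP/mnmP eqA.
have eqAi i : ((i \in A) = k1 i + k2 i :> nat)%N by have := eqA i; rewrite mnmE mnmDE.
have le1 i : (k1 i <= 1)%N by have := eqAi i; case: (i \in A); lia.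
have := p0 [set i | (k1 : 'X_{1..n}) i != 0%N].
rewrite ffunE -mnm_setE // => -> //; first by rewrite mul0r.
apply: Xsub XA; apply/subsetP=> i; rewrite inE => k1i.
by have := eqAi i; case: (i \in A) => //; lia.
Qed.

Lemma sfpartM_eq p p' q : sfpart p = sfpart p' -> sfpart (p * q) = sfpart (p' * q).
Proof.
move=> eqp; apply/eqP; rewrite -subr_eq0 -linearB /= -mulrBl; apply/eqP/ffunP=> A.
rewrite [RHS]ffunE; apply: (@sfpartM0 _ _ predT) => // B _.
by rewrite linearB /= eqp subrr ffunE.
Qed.

Lemma sfpartMX p i : sfpart (p * 'X_i) = mulX i (sfpart p).
Proof.
apply/ffunP=> A; rewrite !ffunE; case: ifP => iA.
  have -> : mnm_set A = (mnm_set (A :\ i) + U_(i))%MM.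
    apply/mnmP=> j; rewrite mnmDE !mnmE !inE eq_sym.
    by case: eqVneq => [<-|_] /=; rewrite ?iA ?addn0.
  by rewrite addmC mcoeffMX.
rewrite mcoeffM big1 // => -[k1 k2] /= /eqP/mnmP/(_ i).
rewrite mnmE iA mnmDE => /esym/eqP; rewrite addn_eq0 => /andP[_ k2i].
rewrite mcoeffX; case: eqP => [eq2|]; last by rewrite mulr0.
by move: k2i; rewrite -eq2 mnm1E eqxx.
Qed.

Lemma up_mulX M v : up M v = \sum_(i in M) mulX i v.
Proof.
apply/ffunP=> A; rewrite sum_ffunE ffunE.
rewrite (eq_bigl (fun i => (i \in M) && (i \in A))) => [|i]; last by rewrite inE andbC.
by rewrite big_mkcondr; apply: eq_bigr => i _; rewrite ffunE.
Qed.

Lemma sfpartM_linform M p : sfpart (p * linform M) = up M (sfpart p).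
Proof.
rewrite mulr_sumr linear_sum up_mulX.
by apply: eq_bigr => i _; apply: sfpartMX.
Qed.

Lemma sfpartM_linformX M p j :
  sfpart (p * linform M ^+ j) = iter j (up M) (sfpart p).
Proof.
elim: j => [|j IHj]; first by rewrite mulr1.
by rewrite exprSr mulrA sfpartM_linform IHj.
Qed.

Lemma mulXC i M v : mulX i (up M v) = up M (mulX i v).
Proof. by rewrite -[v]sfliftK -sfpartM_linform -!sfpartMX -sfpartM_linform mulrAC. Qed.

Lemma mulXX i v : mulX i (mulX i v) = 0.
Proof. by apply/ffunP=> A; rewrite !ffunE; case: ifP => // _; rewrite !inE eqxx. Qed.

Fact mulX_linear i : linear (mulX i).
Proof.
move=> c u v; apply/ffunP=> A; rewrite !ffunE.
by case: ifP => // _; rewrite scaler0 addr0.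
Qed.
HB.instance Definition _ i :=
  GRing.isLinear.Build rat (sqfree n) (sqfree n) _ (mulX i) (mulX_linear i).

Lemma up_setD1 M i v : i \in M -> up (M :\ i) v = up M v - mulX i v.
Proof. by move=> iM; rewrite !up_mulX (big_setD1 i iM) /= addrC addrK. Qed.

(* As x_i squares to 0, (e - x_i)^(m+1) = e^m (e - (m+1) x_i) for a linear form e. *)
Lemma iter_up_setD1 M i v m : i \in M ->
  iter m.+1 (up (M :\ i)) v = iter m (up M) (up M v - m.+1%:R *: mulX i v).
Proof.
move=> iM; elim: m v => [|m IHm] v; first by rewrite /= up_setD1 // scale1r.
rewrite iterSr IHm [RHS]iterSr; congr (iter m _ _).
have XU : mulX i (up M v - mulX i v) = up M (mulX i v).
  by rewrite linearB /= mulXX subr0 mulXC.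
have UB u w : up M (u - w) = up M u - up M w by rewrite linearB.
have UZ c u : up M (c *: u) = c *: up M u by rewrite linearZ.
rewrite up_setD1 // XU !UB UZ -addrA -opprD; congr (_ - _).
by rewrite -[in RHS]addn1 natrD scalerDl scale1r addrC.
Qed.

(** Dropping a variable from the linear form costs one power of e_1, by [iter_up_setD1]. *)
Lemma iter_up_setC c C m v : #|C| = c ->
  exists w, iter (m + c) (up (~: C)) v = iter m U w.
Proof.
elim: c C v => [|c IHc] C v cardC.
  by exists v; rewrite addn0 (cards0_eq cardC) setC0.
have [i iC] : exists i, i \in C by apply/set0Pn; rewrite -card_gt0 cardC.
have cardC' : #|C :\ i| = c by apply/eqP; rewrite -eqSS -cardC (cardsD1 i C) iC.
have -> : ~: C = ~: (C :\ i) :\ i.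
  by apply/setP=> j; rewrite !inE negb_and negbK; case: eqVneq => [->|]; rewrite ?iC.
rewrite addnS iter_up_setD1; last by rewrite !inE eqxx.
exact: IHc.
Qed.

(** The factor j! counts the orders in which the j elements of A outside Q can be added. *)
Lemma iter_up_delta M Q j A :
  iter j (up M) (delta Q) A =
  (if [&& Q \subset A, A :\: Q \subset M & #|A| == (#|Q| + j)%N] then j`!%:R else 0).
Proof.
elim: j A => [|j IHj] A.
  rewrite /= ffunE addn0; case: eqVneq => [->|neAQ].
    by rewrite subxx setDv sub0set eqxx.
  case: ifP => // /and3P[QA _ cardA]; case/eqP: neAQ; apply/esym/eqP.
  by rewrite eqEcard QA (eqP cardA) leqnn.
rewrite iterS ffunE; case: ifP => [/and3P[QA AQM /eqP cardA] | nA].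
  rewrite (bigID [in Q]) /= big1 ?add0r => [|i /andP[_ iQ]]; last first.
    by rewrite IHj ifF // subsetD1 iQ andbF.
  rewrite (eq_bigl [in A :\: Q]) => [|i]; last first.
    rewrite !inE; case iQ: (i \in Q); rewrite ?andbF //= andbT.
    case iA: (i \in A) => //=; apply: (subsetP AQM).
    by rewrite inE iQ iA.
  rewrite (eq_bigr (fun=> j`!%:R)) => [|i].
    rewrite sumr_const cardsD (setIidPr QA) cardA addKn factS mulnC natrM.
    exact/esym/(@mulr_natr rat).
  rewrite inE => /andP[iQ iA]; rewrite IHj ifT //; apply/and3P; split.
  - by rewrite subsetD1 QA.
  - by apply: subset_trans AQM; apply: setSD; apply: subsetDl.
  - by rewrite -eqSS -addnS -cardA (cardsD1 i A) iA.
apply: big1 => i; rewrite inE => /andP[iA iM]; rewrite IHj ifF //.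
apply/negP => /and3P[QA AQM /eqP cardA]; case/negP: nA; apply/and3P; split.
- by apply: subset_trans QA (subsetDl _ _).
- apply/subsetP=> x; rewrite inE => /andP[xQ xA].
  have [->//|ne_xi] := eqVneq x i.
  by apply: (subsetP AQM); rewrite !inE xQ ne_xi.
- by rewrite (cardsD1 i A) iA cardA addnS.
Qed.

(** Modulo squares, e_d is the divided power e_1^d / d! in any set of variables. *)
Lemma sfpart_esym A d : sfpart (esym_in A d) = (d`!%:R)^-1 *: iter d (up A) (delta set0).
Proof.
apply/ffunP=> B; rewrite [RHS]ffunE iter_up_delta sub0set cards0 setD0 add0n /=.
rewrite linear_sum sum_ffunE.
have sfm (E : {set 'I_n}) : sfpart (\prod_(i in E) 'X_i) = delta E.
  rewrite -sfpartX; congr sfpart; rewrite mpolyXE_id [RHS](bigID [in E]) /= [X in _ = _ * X]big1 ?mulr1.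
    by apply: eq_bigr => i iE; rewrite mnmE iE.
  by move=> i /negPf iE; rewrite mnmE iE.
have [subAB | nsub] := boolP ((B \subset A) && (#|B| == d)).
  rewrite (bigD1 B) //= sfm ffunE eqxx big1 ?addr0 => [|E /andP[_ neEB]].
    by rewrite [_ *: _]mulVf // pnatr_eq0 -lt0n fact_gt0.
  by rewrite sfm ffunE eq_sym (negPf neEB).
rewrite scaler0; apply: big1 => E subE; rewrite /= sfm ffunE.
by case: eqP => // eqBE; rewrite eqBE subE in nsub.
Qed.

Lemma sfpart_mesym d : sfpart (mesym n rat d) = (d`!%:R)^-1 *: iter d U (delta set0).
Proof.
rewrite -sfpart_esym; congr sfpart; rewrite /esym_in /mesym.
by apply: eq_bigl => B; rewrite subsetT.
Qed.

Definition permact (s : 'S_n) v : sqfree n := [ffun A : {set 'I_n} => v (s @^-1: A)].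

Lemma sfpart_msym s p : sfpart (msym s p) = permact s (sfpart p).
Proof.
apply/ffunP=> A; rewrite !ffunE mcoeff_sym; congr (_@__).
by apply/mnmP=> i; rewrite !mnmE inE.
Qed.

Lemma msym_linform s : msym s (linform setT) = linform setT.
Proof.
rewrite /linform linear_sum /= [RHS](reindex_inj (@perm_inj _ s)) /=.
apply: eq_big => [i|i _]; first by rewrite !inE.
rewrite msymX; congr 'X_[_]; apply/mnmP=> j; rewrite !mnmE.
by rewrite -(inj_eq (@perm_inj _ s)) permKV.
Qed.

Lemma permact_up s v : permact s (U v) = U (permact s v).
Proof.
rewrite -[v]sfliftK -sfpartM_linform -!sfpart_msym msymM msym_linform.
exact: sfpartM_linform.
Qed.

End SquarefreePart.

(** * Closure properties of the ideal *)

Section Ideal.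
Variables (n : nat) (la : seq nat) (s : nat).
Local Notation I := (@I_ideal n la s).

Lemma I_ideal0 : I 0.
Proof. by exists [::] => //; rewrite big_nil. Qed.

Lemma I_idealD p q : I p -> I q -> I (p + q).
Proof.
case=> r1 gen1 ->; case=> r2 gen2 ->; exists (r1 ++ r2); last by rewrite big_cat.
by move=> g; rewrite mem_cat => /orP[/gen1|/gen2].
Qed.

Lemma I_idealM p q : I p -> I (q * p).
Proof.
case=> r gen ->; exists [seq (q * g.1, g.2) | g <- r].
  by move=> g /mapP[g' /gen Ig ->].
by rewrite big_map mulr_sumr; apply: eq_bigr => g _; rewrite mulrA.
Qed.

Lemma I_idealZ c p : I p -> I (c *: p).
Proof. by rewrite -mul_mpolyC; apply: I_idealM. Qed.

Lemma I_ideal_sum (J : Type) (r : seq J) (P : pred J) (F : J -> {mpoly rat[n]}) :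
  (forall i, P i -> I (F i)) -> I (\sum_(i <- r | P i) F i).
Proof. by move=> IF; apply: big_ind IF; [apply: I_ideal0 | apply: I_idealD]. Qed.

Lemma I_ideal_gen p : I_gen la s p -> I p.
Proof.
move=> gen; exists [:: (1, p)]; last by rewrite big_seq1 mul1r.
by move=> g; rewrite inE => /eqP->.
Qed.

Lemma I_ideal_var i : I ('X_i ^+ s).
Proof. by apply: I_ideal_gen; left; exists i. Qed.

Lemma I_ideal_esym (A : {set 'I_n}) d :
  (#|A| < d + \sum_(n - #|A| <= j < n) conj_part la j)%N -> I (esym_in A d).
Proof. by move=> ltA; apply: I_ideal_gen; right; exists A, d. Qed.

(** A monomial that is not squarefree is a multiple of some x_i^2, hence of x_i^s, so only the
    squarefree monomials need checking. *)
Lemma I_ideal_sfpart p : (s <= 2)%N ->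
  (forall A, sfpart p A != 0 -> I 'X_[mnm_set A]) -> I p.
Proof.
move=> le_s2 Ip; rewrite (mpolyE p) big_seq_cond; apply: I_ideal_sum => m.
rewrite andbT mcoeff_msupp => pm; apply: I_idealZ.
have [/forallP le1 | ] := boolP [forall i, (m i <= 1)%N].
  by rewrite (mnm_setE le1); apply: Ip; rewrite ffunE -mnm_setE.
rewrite negb_forall => /existsP[i]; rewrite -ltnNge => lt1.
have -> : m = ((m - U_(i) *+ s) + U_(i) *+ s)%MM.
  rewrite submK //; apply/mnm_lepP=> j; rewrite mulmnE mnm1E.
  by case: eqVneq => [<-|] //; rewrite mul1n; apply: leq_trans le_s2 _.
by rewrite mpolyXD -mpolyXn; apply/I_idealM/I_ideal_var.
Qed.

Lemma I_ideal_sfpart_eq p q : (s <= 2)%N -> sfpart p = sfpart q -> I q -> I p.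
Proof.
move=> le_s2 eqpq Iq; rewrite -[p](subrK q); apply: I_idealD => //.
by apply: I_ideal_sfpart => // A; rewrite linearB /= eqpq subrr ffunE eqxx.
Qed.

Lemma sfpart_ideal (K : sqfree n -> Prop) p :
    K 0 -> (forall u v, K u -> K v -> K (u + v)) ->
    (forall q1 q2, K (sfpart q1) -> K (sfpart (q1 * q2))) ->
    (forall q, I_gen la s q -> K (sfpart q)) ->
  I p -> K (sfpart p).
Proof.
move=> K0 KD KM Kg [r gen ->]; rewrite linear_sum big_seq.
by apply: big_ind => // g /gen/Kg Kg2; rewrite mulrC; apply: KM.
Qed.

End Ideal.

(** * The ideal in terms of squarefree parts *)

(* [Lam r d] marks the copies e_1^(d-r) H_r of V_(n-r,r) that survive in the quotient,  *)
(* where H_r is the kernel of [down setT] in degree r.                                  *)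
Definition adapted n la s (Lam : nat -> nat -> bool) (K : sqfree n -> Prop) : Prop :=
  [/\ forall p, I_ideal la s p <-> K (sfpart p),
      forall r d h, (r <= d)%N -> ~~ Lam r d -> homdeg r h -> down setT h = 0 ->
        K (iter (d - r) (up setT) h)
    & forall h : nat -> nat -> sqfree n,
        (forall r d, Lam r d -> [/\ (r <= d <= n)%N, homdeg r (h r d) & down setT (h r d) = 0]) ->
        K (\sum_(d < n.+1) \sum_(r < d.+1 | Lam r d) iter (d - r) (up setT) (h r d)) ->
      forall r d, Lam r d -> h r d = 0].

Lemma proj_iter_up n d m (w : sqfree n) :
  proj d (iter m (up setT) w) =
  if (m <= d)%N then iter m (up setT) (proj (d - m) w) else 0.
Proof.
elim: m d => [|m IHm] d; first by rewrite subn0.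
case: d => [|d]; first by rewrite /= proj_up0.
rewrite iterS proj_up IHm ltnS subSS; case: ifP => // _.
by rewrite linear0.
Qed.

Lemma proj_sum_graded n (Lam : nat -> nat -> bool) (h : nat -> nat -> sqfree n) e :
    (forall r d, Lam r d -> homdeg r (h r d)) -> (e <= n)%N ->
  proj e (\sum_(d < n.+1) \sum_(r < d.+1 | Lam r d) iter (d - r) (up setT) (h r d)) =
  \sum_(r < e.+1 | Lam r e) iter (e - r) (up setT) (h r e).
Proof.
move=> hh le_en.
have hom_term d (r : 'I_d.+1) : Lam r d -> homdeg d (iter (d - r) (up setT) (h r d)).
  by move=> /hh/(hom_iter_up (j := d - r)); rewrite subnKC // -ltnS.
rewrite linear_sum (bigD1 (Ordinal (le_en : e < n.+1)%N)) //= linear_sum /=.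
rewrite [X in _ + X]big1 ?addr0 => [|d ne_de].
  by apply: eq_bigr => r Lrd; apply/proj_hom/hom_term.
rewrite linear_sum big1 //= => r Lrd; apply: proj_hom0 (hom_term _ _ Lrd) _.
by apply: contraNneq ne_de => eq_de; apply/eqP/val_inj.
Qed.

Lemma sum_lt_part m n a : (\sum_(m <= i < n) (i < a))%N = (minn a n - m)%N.
Proof.
elim: n => [|n IHn]; first by rewrite big_geq // minn0.
have [le_mn|lt_nm] := leqP m n; last by rewrite big_geq //; lia.
by rewrite big_nat_recr //= IHn; lia.
Qed.

Lemma sfpart_linformX n j : sfpart (linform setT ^+ j) = iter j (up setT) (delta (@set0 'I_n)).
Proof. by rewrite -sfpart1 -sfpartM_linformX mul1r. Qed.

Lemma sfpart_esym_card n (A : {set 'I_n}) : sfpart (esym_in A #|A|) = sfpart 'X_[mnm_set A].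
Proof.
rewrite sfpart_esym sfpartX; apply/ffunP=> B; rewrite !ffunE iter_up_delta.
rewrite sub0set cards0 setD0 add0n /= [B == A]eqEcard.
case: (boolP (B \subset A)) => BA; rewrite /= ?scaler0 //.
rewrite eqn_leq subset_leq_card //=; case: leqP => _; last by rewrite scaler0.
by rewrite [_ *: _]mulVf // pnatr_eq0 -lt0n fact_gt0.
Qed.

(** The first two inequalities say that U^(d-r) H_r can be nonzero; the last two are d <= n-a and
    d-r <= n-a-b. *)
Definition Lambda2 n a b r d : bool :=
  [&& (r <= d)%N, (d + r <= n)%N, (d + a <= n)%N & (d + (a + b) <= n + r)%N].

(** * Two rows, s = 2 *)

Section TwoRows.
Variables n a b : nat.
Hypotheses (b_gt0 : (0 < b)%N) (le_ba : (b <= a)%N) (le_abn : (a + b <= n)%N).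
Local Notation U := (@up n setT).
Local Notation D := (@down n setT).
Local Notation I := (@I_ideal n [:: a; b] 2).
Local Notation N := (n - (a + b))%N.

Definition K2 (v : sqfree n) : Prop := exists w z,
  v = iter N.+1 U w + z /\ forall A, z A != 0 -> (n - a < #|A|)%N.

Lemma sum_conj_part2 m :
  (\sum_(m <= j < n) conj_part [:: a; b] j)%N = ((a - m) + (b - m))%N.
Proof.
rewrite /conj_part /= (eq_bigr (fun j => (j < a) + (j < b))%N) => [|j _]; last by rewrite addn0.
by rewrite big_split /= !sum_lt_part; lia.
Qed.

Lemma K2_im w : K2 (iter N.+1 U w).
Proof. by exists w, 0; rewrite addr0; split=> // A; rewrite ffunE eqxx. Qed.

Lemma K2_high (z : sqfree n) : (forall A, z A != 0 -> (n - a < #|A|)%N) -> K2 z.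
Proof. by move=> hz; exists 0, z; rewrite iter_lin0 add0r. Qed.

Lemma K2_D u v : K2 u -> K2 v -> K2 (u + v).
Proof.
move=> [w1 [z1 [-> h1]]] [w2 [z2 [-> h2]]]; exists (w1 + w2), (z1 + z2).
rewrite iter_linD addrACA; split=> // A; rewrite ffunE.
by have [-> | /h1//] := eqVneq (z1 A) 0; rewrite add0r => /h2.
Qed.

Lemma K2_M p q : K2 (sfpart p) -> K2 (sfpart (p * q)).
Proof.
move=> [w [z [eqp hz]]].
rewrite (sfpartM_eq (p' := sflift w * linform setT ^+ N.+1 + sflift z)); last first.
  by rewrite linearD /= sfpartM_linformX !sfliftK.
rewrite mulrDl mulrAC linearD /= sfpartM_linformX; apply: K2_D; first exact: K2_im.
apply: K2_high => A; apply: contraR; rewrite -leqNgt => leA; apply/eqP.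
apply: (@sfpartM0 _ _ _ (fun A : {set 'I_n} => #|A| <= n - a)%N) => // [B C BC | B leB].
  by apply: leq_trans; apply: subset_leq_card.
by rewrite sfliftK; apply/eqP; apply: contraT => /hz; rewrite ltnNge leB.
Qed.

Lemma K2_gen p : I_gen [:: a; b] 2 p -> K2 (sfpart p).
Proof.
case=> [[i ->] | [A [d [ltd ->]]]].
  rewrite expr2 -[X in X * _]mul1r !sfpartMX mulXX.
  by apply: K2_high => B; rewrite ffunE eqxx.
rewrite sum_conj_part2 in ltd; rewrite sfpart_esym.
have KZ c v : K2 v -> K2 (c *: v).
  case=> w [z [-> hz]]; exists (c *: w), (c *: z); rewrite iter_linZ scalerDr.
  by split=> // B; rewrite ffunE scaler_eq0 negb_or => /andP[_ /hz].
apply: KZ.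
have [lt_nd | le_dn] := ltnP (n - a) d.
  apply: K2_high => B; rewrite iter_up_delta; case: ifP => [/and3P[_ _ /eqP->]|].
    by rewrite cards0.
  by rewrite eqxx.
have [lt_Ad | le_dA] := ltnP #|A| d.
  apply: K2_high => B; rewrite iter_up_delta ifF ?eqxx //.
  apply/negP => /and3P[_ BA /eqP cardB]; move: (subset_leq_card BA).
  by rewrite setD0 cardB cards0 leqNgt lt_Ad.
have cardA := cardsC A; rewrite card_ord in cardA.
(* Put c = |~: A|. If c >= a, the generator condition gives d > |A|; if b <= c < a, it gives d > n -
   a. Both are excluded, so c < b and the condition reads d > N + c. *)
have le_d : (N.+1 + #|~: A| <= d)%N by lia.
rewrite -(subnKC le_d) iterD -[A in up A]setCK.
have [w ->] := iter_up_setC N.+1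
  (iter (d - (N.+1 + #|~: A|)) (up (~: ~: A)) (delta set0)) (erefl #|~: A|).
exact: K2_im.
Qed.

(** Conversely, e_1^(N+1) is a multiple of the generator e_(N+1) in all variables modulo squares,
    and when |A| > n - a the monomial of A is the generator [esym_in A #|A|]. *)
Lemma ideal2E p : I p <-> K2 (sfpart p).
Proof.
split=> [|[w [z [eqp hz]]]].
  apply: sfpart_ideal K2_D K2_M K2_gen => //.
  by apply: K2_high => A; rewrite ffunE eqxx.
apply: (I_ideal_sfpart_eq (q := sflift w * linform setT ^+ N.+1 + sflift z)) => //.
  by rewrite linearD /= sfpartM_linformX !sfliftK.
apply: I_idealD.
  apply: I_idealM; apply: (I_ideal_sfpart_eq (q := (N.+1)`!%:R *: esym_in setT N.+1)) => //.
    rewrite linearZ /= sfpart_esym scalerA divff ?scale1r ?sfpart_linformX //.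
    by rewrite pnatr_eq0 -lt0n fact_gt0.
  by apply/I_idealZ/I_ideal_esym; rewrite cardsT card_ord sum_conj_part2; lia.
apply: I_ideal_sfpart => // A; rewrite sfliftK => /hz ltA.
apply: (I_ideal_sfpart_eq _ (esym (sfpart_esym_card A))) => //.
apply: I_ideal_esym; rewrite sum_conj_part2; lia.
Qed.

Lemma adapted2 : adapted [:: a; b] 2 (Lambda2 n a b) K2.
Proof.
split=> [p|r d h le_rd nL hh Dh|h hP [w [z [eq_sum hz]]] r0 d L0]; first exact: ideal2E.
  have [lt_n | le_drn] := ltnP n (d + r).
    rewrite (iter_up_ker_eq0 hh Dh); last by lia.
    by apply: K2_high => A; rewrite ffunE eqxx.
  have [lt_da | le_da] := ltnP n (d + a).
    by apply: K2_high => A /(hom_iter_up hh) ->; lia.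
  have le_N : (N.+1 <= d - r)%N by move: nL; rewrite /Lambda2; lia.
  by rewrite -(subnKC le_N) iterD; apply: K2_im.
have /and4P[le_r0d le_d1 le_d2 le_d3] := L0.
have le_dn : (d <= n)%N by lia.
have := congr1 (proj d) eq_sum; rewrite proj_sum_graded // => [|r e /hP[]//].
(* Since d <= n - a, the high-degree part z has no component in degree d, and what is left lies in
   the image of U^(N+1). *)
have -> : proj d (iter N.+1 U w + z) =
          iter N.+1 U (if (N.+1 <= d)%N then proj (d - N.+1) w else 0).
  rewrite linearD /= -!iterS proj_iter_up (_ : proj d z = 0) ?addr0.
    by case: ifP => _ //; rewrite iter_lin0.
  apply/ffunP=> A; rewrite !ffunE; case: eqP => // cardA.
  by apply/eqP; apply: contraT => /hz; rewrite cardA; lia.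
set v := \sum_(r < d.+1 | _) _ => eq_v.
have v0 : v = 0.
  (* Every surviving r has d - r <= N, so D^(N+1) kills v. *)
  apply: iter_up_im_eq0 eq_v; rewrite /v iter_lin_sum big1 // => r /[dup] L /hP[le_rd hr Dr].
  by apply: iter_down_up0 hr Dr _; move: L; rewrite /Lambda2; lia.
pose g r := if Lambda2 n a b r d then h r d else 0.
suff : g r0 = 0 by rewrite /g L0.
apply: (@iter_up_free n g d) => // [r le_rd|].
  rewrite /g; case: ifP => [/[dup] L /hP[_ hr Dr]|_].
    by split=> // _; move: L; rewrite /Lambda2; lia.
  by rewrite linear0; split=> // [A|]; rewrite ?ffunE eqxx.
rewrite -[RHS]v0 /v [RHS]big_mkcond /=; apply: eq_bigr => r _; rewrite /g.
by case: ifP => // _; rewrite iter_lin0.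
Qed.

End TwoRows.

(** * One row, s = 1: the quotient is Q *)

Section OneRow.
Variables n k : nat.
Hypotheses (k_gt0 : (0 < k)%N) (le_kn : (k <= n)%N).

Definition Lambda1 (r d : nat) : bool := (r == 0%N) && (d == 0%N).

Definition K1 (v : sqfree n) : Prop := v set0 = 0.

Lemma sfpart_set0M (p q : {mpoly rat[n]}) : K1 (sfpart p) -> K1 (sfpart (p * q)).
Proof.
move=> p0; apply: (@sfpartM0 _ _ _ (pred1 set0)) => [A B AB /eqP B0|A /eqP->|] //=.
by move: AB; rewrite B0 subset0.
Qed.

Lemma ideal1E p : I_ideal [:: k] 1 p <-> K1 (sfpart p).
Proof.
split=> [|p0].
  apply: (sfpart_ideal (K := K1)) => [|u v u0 v0|q1 q2|q].
  - by rewrite /K1 ffunE.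
  - by rewrite /K1 ffunE u0 v0 addr0.
  - exact: sfpart_set0M.
  rewrite /K1; case=> [[i ->] | [A [d [ltd ->]]]].
    by rewrite expr1 -[X in sfpart X]mul1r sfpartMX ffunE inE.
  rewrite sfpart_esym ffunE iter_up_delta cards0 ifF ?scaler0 //.
  (* Only e_0 = 1 has a constant term, and d = 0 would require |A| < k - (n - |A|), impossible as k
     <= n. *)
  case: d ltd => [|d _]; last by rewrite !andbF.
  rewrite (eq_bigr (fun j => (j < k)%N : nat)) => [|j _]; last by rewrite /conj_part /= addn0.
  by rewrite sum_lt_part; have := max_card [in A]; rewrite card_ord; lia.
apply: I_ideal_sfpart => // A; have [->|/set0Pn[i iA] _] := eqVneq A set0.
  by rewrite p0 eqxx.
have -> : mnm_set A = (mnm_set (A :\ i) + U_(i))%MM.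
  apply/mnmP=> j; rewrite mnmDE !mnmE !inE eq_sym.
  by case: eqVneq => [<-|_] /=; rewrite ?iA ?addn0.
by rewrite mpolyXD; apply/I_idealM/I_ideal_var.
Qed.

Lemma adapted1 : adapted [:: k] 1 Lambda1 K1.
Proof.
split=> [p|r d h le_rd nL hh Dh|h hP]; first exact: ideal1E.
  apply/eqP; apply: contraT => /(hom_iter_up hh); rewrite cards0 => /esym/eqP.
  by rewrite subnKC // => /eqP d0; move: nL le_rd; rewrite /Lambda1 d0; lia.
rewrite /K1 => sum0 r d /[dup] L /andP[/eqP r0 /eqP d0]; subst r d.
have hom0 r d : Lambda1 r d -> homdeg r (h r d) by case/hP.
have [_ h0 _] := hP 0%N 0%N L.
have := proj_sum_graded hom0 (leq0n n).
rewrite [RHS]big_mkcond [RHS]big_ord_recl [X in _ = _ + X]big_ord0 /= addr0 => /ffunP/(_ set0).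
rewrite ffunE cards0 eqxx sum0 => h00.
apply/ffunP=> A; rewrite ffunE; apply/eqP; apply: contraT => /[dup] hA /h0 /eqP.
by rewrite cards_eq0 => /eqP A0; rewrite A0 -h00 eqxx in hA.
Qed.

End OneRow.

(** * Specht polynomials of two-row fillings *)

(** Fillings need not be standard, since the Specht module is spanned by all polytabloids. An empty
    second row is dropped, shapes having no zero parts. *)
Definition two_row n (T : tableau n) (r0 r1 : seq 'I_n) : Prop :=
  [/\ T = (if r1 is [::] then [:: r0] else [:: r0; r1]),
      perm_eq (r0 ++ r1) (enum 'I_n) & (size r1 <= size r0)%N].

(** For Q the second row of T this is the Specht polynomial, the product over q in Q of x_q minus
    the variable of the entry below q. *)
Definition polytab n (T : tableau n) (Q : {set 'I_n}) : sqfree n :=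
  \sum_(tau in col_stab T) (-1) ^+ tau *: delta (tau @: Q).

Lemma permact_delta n (s : 'S_n) (Q : {set 'I_n}) : permact s (delta Q) = delta (s @: Q).
Proof.
apply/ffunP=> A; rewrite !ffunE; congr (_%:R); congr nat_of_bool; apply/eqP/eqP => [<-|->].
  apply/setP=> i; rewrite -[i](permKV s) mem_imset ?inE //; exact: perm_inj.
by apply/setP=> i; rewrite inE mem_imset //; apply: perm_inj.
Qed.

Fact permact_linear n (s : 'S_n) : linear (@permact n s).
Proof. by move=> c u v; apply/ffunP=> A; rewrite !ffunE. Qed.
HB.instance Definition _ n s :=
  GRing.isLinear.Build rat (sqfree n) (sqfree n) _ (@permact n s) (@permact_linear n s).

Lemma permact_iter_up n (s : 'S_n) j v :
  permact s (iter j (up setT) v) = iter j (up setT) (permact s v).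
Proof. by elim: j => //= j IHj; rewrite permact_up IHj. Qed.

Lemma down_delta n (B : {set 'I_n}) :
  down setT (delta B) = \sum_(i in B) delta (B :\ i).
Proof.
apply/ffunP=> A; rewrite sum_ffunE ffunE setTD.
rewrite [LHS]big_mkcond [RHS]big_mkcond; apply: eq_bigr => i _; rewrite inE !ffunE.
case: ifP => iA; case: ifP => iB //=.
- by congr (_%:R); congr nat_of_bool; apply/eqP/eqP => [<-|->]; rewrite ?setU1K ?setD1K.
- by case: eqP => // eqB; rewrite -eqB !inE eqxx in iB.
- by case: eqP => // eqA; rewrite eqA !inE eqxx in iA.
Qed.

Section TwoRowFilling.
Variables (n : nat) (T : tableau n) (r0 r1 : seq 'I_n).
Hypothesis TE : two_row T r0 r1.
Local Notation Q := [set i in r1].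
Local Notation U := (@up n setT).

Let uniqT : uniq (r0 ++ r1).
Proof. by case: TE => _ /perm_uniq-> _; apply: enum_uniq. Qed.

Lemma two_row_notin i : (i \in r0) = (i \notin r1).
Proof.
have [_ /perm_mem/(_ i)] := TE; rewrite mem_enum mem_cat inE => + _.
move: uniqT; rewrite cat_uniq => /and3P[_ /hasPn nh _].
by case r1i: (i \in r1); [move=> _; apply/negbTE/nh | rewrite orbF].
Qed.

Lemma row_of_two_row i : row_of T i = (i \in r1).
Proof.
have [-> _ _] := TE; rewrite /row_of; have := two_row_notin i.
by case: r1 => [|x s] /=; rewrite ?in_nil => ->//; case: (i \in _).
Qed.

Lemma col_of_two_row i : col_of T i = if i \in r1 then index i r1 else index i r0.
Proof.
rewrite /col_of row_of_two_row; have [-> _ _] := TE.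
by case: r1 => [|x s] //=; case: (i \in _).
Qed.

Lemma size_two_row : (size r0 + #|Q| = n)%N.
Proof.
have [_ /perm_size + _] := TE; rewrite size_cat size_enum_ord cardsE => szT.
have /and3P[_ _ /card_uniqP->] := etrans (esym (cat_uniq _ _)) uniqT.
exact: szT.
Qed.

Lemma card_second_row : #|Q| = size r1.
Proof. by rewrite cardsE; move: uniqT; rewrite cat_uniq => /and3P[_ _ /card_uniqP]. Qed.

(** The entry below q; as r1 is no longer than r0, the default is never reached for q in r1. *)
Definition partner (q : 'I_n) : 'I_n := nth q r0 (index q r1).

Lemma partner_in q : q \in r1 -> partner q \in r0.
Proof.
move=> qr1; apply: mem_nth; have [_ _] := TE; apply: leq_trans.
by rewrite index_mem.
Qed.

Lemma partner_notin q : q \in r1 -> partner q \notin r1.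
Proof. by move=> /partner_in; rewrite two_row_notin. Qed.

Let uniq_r0 : uniq r0.
Proof. by move: uniqT; rewrite cat_uniq => /and3P[]. Qed.

Lemma col_of_partner q : q \in r1 -> col_of T (partner q) = col_of T q.
Proof.
move=> qr1; rewrite !col_of_two_row qr1 (negPf (partner_notin qr1)) index_uniq //.
by have [_ _] := TE; apply: leq_trans; rewrite index_mem.
Qed.

Lemma col_stabP (s : 'S_n) : reflect (forall i, col_of T (s i) = col_of T i) (s \in col_stab T).
Proof. by rewrite inE; apply: (iffP forallP) => cs i; apply/eqP. Qed.

Lemma row_stabP (s : 'S_n) : reflect (forall i, (s i \in r1) = (i \in r1)) (s \in row_stab T).
Proof.
rewrite inE; apply: (iffP forallP) => cs i; have := cs i; rewrite !row_of_two_row.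
  by do 2!case: (_ \in _).
by move=> ->.
Qed.

Lemma col_stab_second (s : 'S_n) q : s \in col_stab T -> q \in r1 -> s q = q \/ s q = partner q.
Proof.
move=> /col_stabP/(_ q) + qr1; rewrite !col_of_two_row qr1; case: ifP => sq.
  by move/(index_inj q sq qr1); left.
move/negbT: sq; rewrite -two_row_notin => sq eq_i; right.
by rewrite /partner -eq_i nth_index.
Qed.

Lemma homdeg_polytab : homdeg #|Q| (polytab T Q).
Proof.
move=> A; apply: contraNeq => neA; rewrite sum_ffunE big1 // => tau _.
rewrite !ffunE; case: eqP => [eqA|_]; last by rewrite scaler0.
by rewrite eqA card_imset ?eqxx // in neA; apply: perm_inj.
Qed.

(* Precomposition with the transposition of q and its column partner changes the sign   *)
(* and permutes the terms in which q has been deleted.                                  *)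
Lemma down_polytab : down setT (polytab T Q) = 0.
Proof.
rewrite linear_sum /=.
under eq_bigr => tau _.
  rewrite linearZ /= down_delta big_imset /=; last by move=> i j _ _; apply: perm_inj.
  rewrite scaler_sumr; over.
rewrite exchange_big big1 //= => q; rewrite inE => qr1.
pose t := tperm (partner q) q.
have neq_pq : partner q != q by apply: contraNneq (partner_notin qr1) => ->.
have tcol : t \in col_stab T.
  apply/col_stabP=> i; rewrite /t; case: tpermP => [->|->|//]; last by rewrite col_of_partner.
  by rewrite col_of_partner.
set X := \sum_(_ in _) _; suff : X = - X.
  by move/eqP; rewrite -subr_eq0 opprK -mulr2n -scaler_nat scaler_eq0 => /orP[|/eqP].
rewrite {1}/X (reindex_inj (@mulgI _ t)) /= -sumrN.
apply: eq_big => [tau|tau _].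
  apply/idP/idP => /col_stabP ct; apply/col_stabP=> i.
    by have := ct (t i); rewrite permM tpermK => ->; apply/col_stabP.
  by rewrite permM ct; apply/col_stabP.
rewrite -scaleNr odd_mul_tperm neq_pq signr_addb expr1 mulN1r; congr (_ *: delta _).
rewrite permM tpermR.
have setE (s : 'S_n) : s @: Q :\ s q = s @: (Q :\ q).
  apply/setP=> x; rewrite -[x](permKV s) !inE (inj_eq perm_inj) !mem_imset ?inE //; exact: perm_inj.
have -> : (t * tau)%g @: Q :\ tau (partner q) = (t * tau)%g @: (Q :\ q).
  by rewrite -setE permM tpermR.
rewrite setE; apply/setP=> x; apply/imsetP/imsetP => -[y yQ ->]; exists y => //.
  rewrite permM tpermD //.
    by move: yQ; rewrite !inE => /andP[_]; apply: contraTneq => <-; apply: partner_notin.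
  by move: yQ; rewrite !inE eq_sym => /andP[].
rewrite permM tpermD //.
  by move: yQ; rewrite !inE => /andP[_]; apply: contraTneq => <-; apply: partner_notin.
by move: yQ; rewrite !inE eq_sym => /andP[].
Qed.

(** A column permutation replaces some q by their smaller partners, which lowers the weight. If it
    preserves Q, it fixes rows and columns, so it is the identity. *)
Lemma polytab_lead : (forall q, q \in r1 -> (partner q < q)%N) ->
  polytab T Q Q = 1 /\ forall A, polytab T Q A != 0 -> (weight A <= weight Q)%N.
Proof.
move=> ltp; split=> [|A].
  have one_in : 1%g \in col_stab T by apply/col_stabP=> i; rewrite perm1.
  rewrite sum_ffunE (bigD1 1%g) //= big1 => [|tau /andP[ct ne1]].
    rewrite odd_perm1 !ffunE (eq_imset (g := id)); last by move=> i; rewrite perm1.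
    by rewrite imset_id eqxx addr0 [_ *: _]mulr1.
  rewrite !ffunE; case: eqP => [eqQ|_]; last by rewrite scaler0.
  case/eqP: ne1; apply/permP=> i; rewrite perm1.
  have ti : (tau i \in r1) = (i \in r1).
    have : (tau i \in tau @: Q) = (i \in Q) by rewrite mem_imset //; apply: perm_inj.
    by rewrite -eqQ !inE.
  have [i1 | i0] := boolP (i \in r1).
    have [//|ti'] := col_stab_second ct i1.
    by have := partner_notin i1; rewrite -ti' ti i1.
  have /col_stabP/(_ i) := ct; rewrite !col_of_two_row ti (negPf i0) => /(index_inj i).
  by apply; rewrite two_row_notin ?ti.
apply: contraR; rewrite -ltnNge => ltw; rewrite sum_ffunE big1 // => tau ct.
rewrite !ffunE; case: eqP => [eqA|_]; last by rewrite scaler0.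
move: ltw; rewrite eqA /weight big_imset /=; last by move=> i j _ _; apply: perm_inj.
rewrite ltnNge leq_sum // => q; rewrite inE => qr1; rewrite leq_exp2l //.
by have [->|->] := col_stab_second ct qr1; last exact/ltnW/ltp.
Qed.

Lemma row_stab_sum_swap (M A : {set 'I_n}) i j : i \notin r1 -> j \notin r1 ->
  (\sum_(s in row_stab T) delta (s @: M)) (tperm i j @: A) =
  (\sum_(s in row_stab T) delta (s @: M)) A :> rat.
Proof.
move=> i0 j0; rewrite !sum_ffunE [LHS](reindex_inj (@mulIg _ (tperm i j))) /=.
have tij k : (tperm i j k \in r1) = (k \in r1).
  by case: tpermP => [->|->|//]; rewrite (negPf i0) (negPf j0).
apply: eq_big => [s|s _].
  apply/row_stabP/row_stabP => rs k; first by rewrite -(rs k) permM tij.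
  by rewrite permM tij rs.
rewrite !ffunE; congr (_%:R); congr nat_of_bool.
rewrite (_ : (s * tperm i j)%g @: M = tperm i j @: (s @: M)); last first.
  by rewrite -imset_comp; apply: eq_imset => k; rewrite permM.
by apply/eqP/eqP => [|->//]; apply: imset_inj; apply: perm_inj.
Qed.

(** Transpositions of first-row entries leave the sum invariant and bring A to B one element at a
    time. *)
Lemma row_stab_sum_const (M A B : {set 'I_n}) : Q \subset A -> Q \subset B -> #|A| = #|B| ->
  (\sum_(s in row_stab T) delta (s @: M)) A =
  (\sum_(s in row_stab T) delta (s @: M)) B :> rat.
Proof.
move: {2}#|A :\: B| (leqnn #|A :\: B|) => m.
elim: m A => [|m IHm] A leAB QA QB cardAB.
  suff -> : A = B by [].
  apply/eqP; rewrite eqEcard cardAB leqnn andbT -setD_eq0 -cards_eq0.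
  by rewrite -leqn0.
have [/eqP|neAB] := eqVneq #|A :\: B| 0%N.
  by rewrite cards_eq0 => /eqP AB0; apply: IHm; rewrite ?AB0 ?cards0.
have [i] : exists i, i \in A :\: B by apply/set0Pn; rewrite -cards_eq0.
rewrite inE => /andP[iNB iA].
have [j] : exists j, j \in B :\: A.
  apply/set0Pn; rewrite -cards_eq0; have := cardsID B A; have := cardsID A B.
  by rewrite setIC; lia.
rewrite inE => /andP[jNA jB].
have iN1 : i \notin r1 by apply: contra iNB => i1; apply: (subsetP QB); rewrite inE.
have jN1 : j \notin r1 by apply: contra jNA => j1; apply: (subsetP QA); rewrite inE.
rewrite -(row_stab_sum_swap M A iN1 jN1).
have tA : tperm i j @: A = j |: (A :\ i).
  apply/setP=> x; have [k ->] : exists k, x = tperm i j k by exists (tperm i j x); rewrite tpermK.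
  rewrite mem_imset; last exact: perm_inj.
  have nij : i != j by apply: contraNneq jNA => <-.
  rewrite !inE; case: tpermP => [->|->|/eqP nki /eqP nkj].
  - by rewrite eqxx iA.
  - by rewrite eqxx (negPf jNA) (negPf nij).
  - by rewrite (negPf nki) (negPf nkj).
apply: IHm => //; rewrite tA.
- have : (A :\: B) :\ i \proper A :\: B by rewrite properD1 // inE iNB iA.
  move/proper_card=> lt_card; rewrite -ltnS; apply: leq_trans leAB; apply: leq_ltn_trans lt_card.
  apply: subset_leq_card; apply/subsetP=> k; rewrite !inE.
  case/andP=> kNB /orP[/eqP kj | /andP[ki kA]]; first by rewrite kj jB in kNB.
  by rewrite ki kNB kA.
- apply/subsetP=> k kQ; rewrite !inE (subsetP QA) // andbT.
  by case: (eqVneq k i) => [eki|_]; rewrite ?orbT //; move: kQ; rewrite eki inE (negPf iN1).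
- by rewrite cardsU1 !inE (negPf jNA) andbF add1n -cardAB (cardsD1 i A) iA.
Qed.

(** Both sides are supported on the sets of size |M| that contain Q, and constant there. The
    constant is positive because the identity contributes 1 at M. *)
Lemma row_stab_sum (M : {set 'I_n}) j : Q \subset M -> #|M| = (#|Q| + j)%N ->
  exists2 kappa : rat, kappa != 0 &
    \sum_(s in row_stab T) delta (s @: M) = kappa *: iter j U (delta Q).
Proof.
move=> QM cardM; set G := \sum_(s in _) _.
have fact0 : (j`!%:R : rat) != 0 by rewrite pnatr_eq0 -lt0n fact_gt0.
have GM0 : (G M : rat) != 0.
  have one_in : 1%g \in row_stab T by apply/row_stabP=> i; rewrite perm1.
  rewrite /G sum_ffunE (bigD1 1%g) //= ffunE (eq_imset (g := id)); last by move=> i; rewrite perm1.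
  rewrite imset_id eqxx; apply: lt0r_neq0; apply: ltr_pwDl => //.
  by apply: sumr_ge0 => s _; rewrite ffunE ler0n.
exists ((G M : rat) / j`!%:R); first by rewrite mulf_neq0 ?invr_eq0.
apply/ffunP=> A; rewrite [RHS]ffunE iter_up_delta subsetT /=.
case: ifP => [/andP[QA /eqP cardA]|nA].
  by rewrite [_ *: _]mulfVK //; apply: row_stab_sum_const; rewrite ?cardA.
rewrite scaler0 /G sum_ffunE big1 // => s /row_stabP rs; rewrite ffunE.
case: eqP => // eqA; case/andP: nA; rewrite eqA card_imset ?cardM ?eqxx; last exact: perm_inj.
split=> //; apply/subsetP=> i iQ; rewrite -[i](permKV s) mem_imset; last exact: perm_inj.
by apply: (subsetP QM); move: iQ; rewrite !inE -[in i \in r1](permKV s i) rs.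
Qed.

Lemma sfpart_prod_uniq (l : seq 'I_n) : uniq l ->
  sfpart (\prod_(i <- l) 'X_i) = delta [set i in l].
Proof.
move=> ul; rewrite -sfpartX; congr sfpart; rewrite big_uniq //= mpolyXE_id.
rewrite [RHS](bigID [in l]) /= [X in _ = _ * X]big1 ?mulr1.
  by apply: eq_bigr => i il; rewrite mnmE inE il.
by move=> i /negPf il; rewrite mnmE inE il.
Qed.

(** The exponents along the rows of T are c zeros followed by ones, so the monomial is that of a set
    M containing the second row. [row_stab_sum] evaluates the row symmetrization, and U commutes
    with the column permutations. *)
Lemma sfpart_F_poly (S : tableau n) c :
    flatten (cc_tableau S) = nseq c 0%N ++ nseq (n - c) 1%N -> (c + #|Q| <= n)%N ->
  exists2 kappa : rat, kappa != 0 &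
    sfpart (F_poly S T) = kappa *: iter (n - c - #|Q|) U (polytab T Q).
Proof.
move=> ccS le_cn.
have flatT : flatten T = r0 ++ r1.
  by have [-> _ _] := TE; case: r1 => [|x s] /=; rewrite !cats0.
have size_flat : size (r0 ++ r1) = n.
  by have [_ /perm_size + _] := TE; rewrite size_enum_ord.
pose M := [set i in drop c (r0 ++ r1)].
have xM : sfpart (x_cc S T) = delta M.
  rewrite -sfpart_prod_uniq ?drop_uniq //; congr sfpart.
  rewrite /x_cc flatT ccS -{1}(cat_take_drop c (r0 ++ r1)) zip_cat; last first.
    by rewrite size_takel ?size_nseq // size_flat; lia.
  rewrite big_cat /= big1_seq ?mul1r => [|u /andP[_]]; last first.
    case: u => i e /(map_f snd) /=.
    have := @unzip2_zip _ _ (take c (r0 ++ r1)) (nseq c 0%N).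
    rewrite /unzip2 => ->; last by rewrite size_takel ?size_nseq // size_flat; lia.
    by rewrite mem_nseq => /andP[_ /eqP->]; rewrite expr0.
  have := size_drop c (r0 ++ r1); rewrite size_flat.
  move: (drop c _) (n - c)%N => l m <-.
  elim: l => [|i l IHl]; first by rewrite !big_nil.
  by rewrite /= !big_cons IHl.
have cardM : #|M| = (n - c)%N.
  rewrite cardsE; have /card_uniqP -> := drop_uniq c uniqT.
  by rewrite size_drop size_flat.
have QM : Q \subset M.
  apply/subsetP=> i; rewrite !inE => i1; have sz := size_two_row.
  rewrite drop_cat; case: ltnP => [_|le_c]; first by rewrite mem_cat i1 orbT.
  by rewrite (_ : (c - size r0 = 0)%N) ?drop0 //; lia.
have [|kappa k0 eqG] := @row_stab_sum M (n - c - #|Q|) QM; first by rewrite cardM; lia.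
exists kappa => //.
rewrite /F_poly /eps linear_sum /= /polytab iter_lin_sum scaler_sumr.
apply: eq_bigr => tau _.
rewrite linear_sum /= iter_linZ -permact_delta -permact_iter_up scalerA mulrC -scalerA.
have actZ e v : e *: permact tau v = permact tau (e *: v) by rewrite linearZ.
rewrite actZ -eqG linear_sum scaler_sumr; apply: eq_bigr => sigma _.
by rewrite linearZ /= !sfpart_msym xM permact_delta.
Qed.

End TwoRowFilling.

(** * Standard tableaux with at most one descent *)

Local Open Scope nat_scope.

(** * Cocharge and catabolism of interval words *)

Section Words.
Implicit Types (c r q : nat) (w x nu : seq nat).

(** The word reads the tableau whose second row is the interval from c to c + r - 1; see
    [reading_word_ivl]. *)
Lemma index_interval_word c r q i :
  index i (iota c r ++ iota 0 c ++ iota (c + r) q) =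
  if i < c then r + i else if i < c + r then i - c else
  if i < c + r + q then i else c + r + q.
Proof.
set w := _ ++ _; have szw : size w = c + r + q by rewrite !size_cat !size_iota; lia.
have idx k : i = nth 0 w k -> k < c + r + q -> index i w = k.
  move=> ->; rewrite -szw => ltk; apply: index_uniq => //.
  rewrite !cat_uniq !iota_uniq !andbT /=; apply/andP; split.
    apply/hasPn => j; rewrite mem_cat !mem_iota; lia.
  by apply/hasPn => j; rewrite !mem_iota; lia.
case: ltnP => [lt_ic|le_ci].
  apply: idx; last by lia.
  by rewrite nth_cat size_iota ltnNge leq_addr /= addKn nth_cat size_iota lt_ic nth_iota.
case: ltnP => [lt_i|le_i].
  apply: idx; last by lia.
  by rewrite nth_cat size_iota ifT ?nth_iota; lia.
case: ltnP => [lt_i'|le_i'].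
  apply: idx => //.
  by rewrite nth_cat size_iota ifF ?nth_cat ?size_iota ?ifF ?nth_iota; lia.
by rewrite memNindex ?szw // !mem_cat !mem_iota; lia.
Qed.

(** The only letter standing to the left of its predecessor is c. *)
Lemma cc_label_interval_word c r q i : 0 < c -> (r = 0 -> q = 0) -> i < c + r + q ->
  cc_label (iota c r ++ iota 0 c ++ iota (c + r) q) i = (c <= i).
Proof.
move=> c_gt0 rq; elim: i => [|i IHi] lti /=; first by rewrite leqNgt c_gt0.
rewrite IHi; last exact: ltnW.
rewrite !index_interval_word lti (ltnW lti).
by do ?case: ifP => ?; lia.
Qed.

Lemma map_const_iota (f : nat -> nat) a m l :
  (forall i, m <= i < m + l -> f i = a) -> map f (iota m l) = nseq l a.
Proof.
elim: l m => //= l IHl m fa; rewrite fa ?IHl // => [i lti|]; last by lia.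
by apply: fa; lia.
Qed.

Lemma cc_interval_word c r q : 0 < c -> (r = 0 -> q = 0) ->
  cc_word (iota c r ++ iota 0 c ++ iota (c + r) q) = nseq r 1 ++ nseq c 0 ++ nseq q 1.
Proof.
move=> c_gt0 rq; rewrite /cc_word !map_cat.
have lab i : i < c + r + q ->
  cc_label (iota c r ++ iota 0 c ++ iota (c + r) q) i = (c <= i).
  exact: cc_label_interval_word.
by rewrite (@map_const_iota _ 1 c) ?(@map_const_iota _ 0 0) ?(@map_const_iota _ 1 (c + r)) //
  => i lei;
  rewrite lab; lia.
Qed.

(** A letter 1 asks for a second part, which the empty partition refuses, so it returns to the front
    as 2. *)
Lemma iter_ctype_ones y q :
  iter q ctype_step (y ++ nseq q 1, [::]) = (nseq q 2 ++ y, [::]).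
Proof.
elim: q y => [|q IHq] y; first by rewrite cats0.
rewrite -addn1 nseqD catA cats1 addn1 iterSr ctype_step_rcons /= (IHq (2 :: y)).
by rewrite -cat1s catA -[[:: 2]]/(nseq 1 2) -nseqD addn1.
Qed.

Lemma iter_ctype_zeros y c m :
  iter c ctype_step (y ++ nseq c 0, nseq (m > 0) m) = (y, nseq (m + c > 0) (m + c)).
Proof.
elim: c m => [|c IHc] m; first by rewrite cats0 addn0.
rewrite -addn1 nseqD catA cats1 addn1 iterSr ctype_step_rcons.
have -> : incr_nth (nseq (0 < m) m) 0 = nseq (0 < m.+1) m.+1 by case: m.
by rewrite (_ : is_part _ = true) // IHc addSnnS.
Qed.

Lemma iter_ctype_second y c r m : m + r <= c ->
  iter r ctype_step (y ++ nseq r 1, c :: nseq (m > 0) m) = (y, c :: nseq (m + r > 0) (m + r)).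
Proof.
elim: r m => [|r IHr] m lec; first by rewrite cats0 addn0.
rewrite -addn1 nseqD catA cats1 addn1 iterSr ctype_step_rcons.
have -> : incr_nth (c :: nseq (0 < m) m) 1 = c :: nseq (0 < m.+1) m.+1 by case: m {IHr lec}.
rewrite (_ : is_part _ = true) ?IHr ?addSnnS //.
by rewrite /is_part /= !inE; lia.
Qed.

(** Letters never decrease, and a letter at least 2 can only enlarge the third or a later part. *)
Lemma iter_ctype_high m x nu : all (leq 2) x ->
  exists x' nu', [/\ iter m ctype_step (x, nu) = (x', nu'), all (leq 2) x',
    nth 0 nu' 0 = nth 0 nu 0 & nth 0 nu' 1 = nth 0 nu 1].
Proof.
elim: m x nu => [|m IHm] x nu ge2; first by exists x, nu.
rewrite iterSr; case/lastP: x ge2 => [|y a]; first by move=> _; apply: IHm.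
rewrite all_rcons => /andP[a2 y2]; rewrite ctype_step_rcons; case: ifP => _.
  have [x' [nu' [-> x2 n0 n1]]] := IHm y (incr_nth nu a) y2; exists x', nu'.
  by rewrite n0 n1 !nth_incr_nth; split=> //; case: eqP => //; lia.
by apply: IHm; rewrite /= y2 ltnW.
Qed.

Lemma sumn_take2 nu : sumn (take 2 nu) = nth 0 nu 0 + nth 0 nu 1.
Proof. by case: nu => [|x [|y nu]] //=; rewrite take0 /= addn0. Qed.

Lemma iter_ctype_interval c r q : 0 < c -> r <= c ->
  iter (q + c + r) ctype_step (nseq r 1 ++ nseq c 0 ++ nseq q 1, [::]) =
  (nseq q 2, c :: nseq (r > 0) r).
Proof.
move=> c_gt0 le_rc; have -> : q + c + r = r + (c + q) by lia.
rewrite iterD iterD catA iter_ctype_ones catA.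
rewrite (iter_ctype_zeros _ c 0) add0n c_gt0 /=.
by rewrite (iter_ctype_second _ (m := 0)).
Qed.

(** For q > 0 the leftover letters 2 change only later parts, so the sum of the first two parts is
    known without computing the whole type; comparison with a two-row partition asks for no more. *)
Lemma ctype_interval_word c r q : 0 < c -> r <= c -> (r = 0 -> q = 0) ->
  let nu := ctype_word (iota c r ++ iota 0 c ++ iota (c + r) q) in
  (q = 0 -> nu = c :: nseq (r > 0) r) /\ nth 0 nu 0 + nth 0 nu 1 = c + r.
Proof.
move=> c_gt0 le_rc rq; have it := iter_ctype_interval q c_gt0 le_rc.
split=> [q0|].
  apply: (@ctype_wordE _ (q + c + r)); rewrite cc_interval_word // it.
  by rewrite q0.
rewrite /ctype_word cc_interval_word //.
set w := iota c r ++ _; have szw : size w = q + c + r by rewrite !size_cat !size_iota; lia.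
have le_sz : q + c + r <= size w * size w by rewrite szw; nia.
rewrite -(subnK le_sz) iterD it.
have [|x' [nu' [-> _ /= -> ->]]] := @iter_ctype_high (size w * size w - (q + c + r))
    (nseq q 2) (c :: nseq (r > 0) r).
  by apply/allP => y; rewrite mem_nseq => /andP[_ /eqP->].
by case: (r).
Qed.

Lemma filter_lt_iota k m l : [seq i <- iota m l | i < k] = iota m (minn l (k - m)).
Proof.
elim: l m => [|l IHl] m /=; first by rewrite min0n.
rewrite IHl; case: ltnP => lt_mk.
  by have -> : minn l.+1 (k - m) = (minn l (k - m.+1)).+1 by lia.
have -> : minn l (k - m.+1) = 0 by lia.
by have -> : minn l.+1 (k - m) = 0 by lia.
Qed.

(** Restrictions stay in the family of interval words, so [ctype_interval_word] applies to them. *)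
Lemma filter_interval_word k c r q :
  let w := [seq i <- iota c r ++ iota 0 c ++ iota (c + r) q | i < k] in
  [/\ k <= c -> w = iota k 0 ++ iota 0 k ++ iota (k + 0) 0,
      c < k <= c + r -> w = iota c (k - c) ++ iota 0 c ++ iota (c + (k - c)) 0
    & c + r < k <= c + r + q -> w = iota c r ++ iota 0 c ++ iota (c + r) (k - (c + r))].
Proof.
rewrite /= !filter_cat !filter_lt_iota subn0.
split=> le_k.
- have [-> -> ->] : [/\ minn r (k - c) = 0, minn c k = k & minn q (k - (c + r)) = 0].
    by split; lia.
  by rewrite /= cats0.
- have [-> -> ->] : [/\ minn r (k - c) = k - c, minn c k = c & minn q (k - (c + r)) = 0].
    by split; lia.
  by [].
- have [-> -> ->] : [/\ minn r (k - c) = r, minn c k = c &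
      minn q (k - (c + r)) = k - (c + r)] by split; lia.
  by [].
Qed.

End Words.

(** * Tableaux with a prescribed second row *)

Section Tableaux.
Variable n : nat.
Implicit Types (S T : tableau n) (Q : {set 'I_n}).

Definition tab2 Q : tableau n :=
  if Q == set0 then [:: enum 'I_n] else [:: enum (~: Q); enum Q].

Definition ivl (c r : nat) : {set 'I_n} := [set i : 'I_n | c <= i < c + r].

Lemma reading_word_restrict k S :
  reading_word (restrict k S) = [seq i <- reading_word S | i < k].
Proof.
have flatF (X : tableau n) : flatten (rev [seq r <- X | r != [::]]) = flatten (rev X).
  elim: X => //= r X IHX; rewrite rev_cons flatten_rcons -IHX.
  by case: eqP => [->|_] /=; rewrite ?cats0 // rev_cons flatten_rcons.
rewrite /reading_word /restrict flatF -map_rev -filter_flatten.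
by rewrite filter_map.
Qed.

Lemma sorted_enum_set Q : sorted (fun i j : 'I_n => i < j) (enum Q).
Proof.
have tr : transitive (fun i j : 'I_n => i < j) by move=> j i k; apply: ltn_trans.
rewrite /enum_mem; apply: (sorted_filter tr); rewrite -enumT.
have : sorted ltn (map val (enum 'I_n)) by rewrite val_enum_ord iota_ltn_sorted.
by rewrite sorted_map.
Qed.

Lemma eq_enum_set (s : seq 'I_n) Q :
  sorted (fun i j : 'I_n => i < j) s -> s =i Q -> s = enum Q.
Proof.
move=> sorted_s sQ.
apply: (@irr_sorted_eq _ (fun i j : 'I_n => i < j)) (sorted_enum_set Q) _ => //.
- by move=> j i k; apply: ltn_trans.
- by move=> i; apply: ltnn.
by move=> i; rewrite mem_enum sQ.
Qed.

Lemma val_enum_ivl c r : c + r <= n -> map val (enum (ivl c r)) = iota c r.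
Proof.
move=> le_crn.
apply: (irr_sorted_eq ltn_trans ltnn); rewrite ?sorted_map ?iota_ltn_sorted ?sorted_enum_set //.
move=> i; rewrite mem_iota; apply/mapP/idP => [[j]|ltic].
  by rewrite mem_enum inE => + ->.
have lt_in : i < n by lia.
by exists (Ordinal lt_in); rewrite // mem_enum inE.
Qed.

Lemma val_enum_ivlC c r : c + r <= n ->
  map val (enum (~: ivl c r)) = iota 0 c ++ iota (c + r) (n - c - r).
Proof.
move=> le_crn.
apply: (irr_sorted_eq ltn_trans ltnn); first by rewrite sorted_map sorted_enum_set.
  have := iota_ltn_sorted 0 (c + (r + (n - c - r))).
  rewrite !iotaD add0n; apply: subseq_sorted; first exact: ltn_trans.
  by rewrite cat_subseq // suffix_subseq.
move=> i; rewrite mem_cat !mem_iota; apply/mapP/idP => [[j]|ltic].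
  by rewrite mem_enum !inE => + -> /=; have := ltn_ord j; lia.
have lt_in : i < n by lia.
by exists (Ordinal lt_in); rewrite // mem_enum !inE /=; lia.
Qed.

(* The parameters of an interval that is the second row of a standard tableau; the      *)
(* empty interval is normalised to start at n.                                          *)
Definition interval_params c r : bool := (r == 0) && (c == n) || (0 < r <= c) && (c + r <= n).

Lemma ivl_eq0 c r : interval_params c r -> (ivl c r == set0) = (r == 0).
Proof.
move=> pcr; apply/eqP/eqP => [/setP ivl0|r0].
  case: r pcr ivl0 => // r pcr ivl0; have lt_cn : c < n by move: pcr; rewrite /interval_params; lia.
  by have := ivl0 (Ordinal lt_cn); rewrite !inE /= leqnn addnS ltnS leq_addr.
by apply/setP=> i; rewrite !inE r0; lia.
Qed.

Lemma reading_word_ivl c r : interval_params c r ->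
  reading_word (tab2 (ivl c r)) = iota c r ++ iota 0 c ++ iota (c + r) (n - c - r).
Proof.
move=> pcr; rewrite /tab2 ivl_eq0 //; case: eqP => [r0|nr0].
  have -> : c = n by move: pcr; rewrite /interval_params; lia.
  rewrite r0 subnn /= !cats0 /reading_word /= cats0.
  exact: val_enum_ord.
have le_crn : c + r <= n by move: pcr; rewrite /interval_params; lia.
by rewrite /reading_word /= cats0 map_cat val_enum_ivl // val_enum_ivlC.
Qed.

Lemma flatten_cc_ivl c r : 0 < n -> interval_params c r ->
  flatten (cc_tableau (tab2 (ivl c r))) = nseq c 0 ++ nseq (n - c) 1.
Proof.
move=> n_gt0 pcr; rewrite /cc_tableau reading_word_ivl //.
have c_gt0 : 0 < c by move: pcr; rewrite /interval_params; lia.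
have rq : r = 0 -> n - c - r = 0 by move: pcr; rewrite /interval_params; lia.
have mapE (s : seq 'I_n) :
    [seq cc_label (iota c r ++ iota 0 c ++ iota (c + r) (n - c - r)) (val i) | i <- s]
    = map (fun i => nat_of_bool (c <= i)) (map val s).
  rewrite -map_comp; apply: eq_map => i /=; rewrite cc_label_interval_word //.
  by have := ltn_ord i; move: pcr; rewrite /interval_params; lia.
rewrite /tab2 ivl_eq0 //; case: eqP => [r0|nr0] /=.
  have cn : c = n by move: pcr; rewrite /interval_params; lia.
  rewrite mapE val_enum_ord cn subnn (@map_const_iota _ 0) // => i; lia.
have le_crn : c + r <= n by move: pcr; rewrite /interval_params; lia.
rewrite !mapE val_enum_ivl // val_enum_ivlC // map_cat !cats0.
rewrite (@map_const_iota _ 0) => [|i]; last by lia.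
rewrite !(@map_const_iota _ 1) => [|i|i]; try lia.
by rewrite -catA -nseqD; congr (_ ++ nseq _ _); lia.
Qed.

Lemma ctype_restrict_ivl k c r : 0 < k <= n -> interval_params c r ->
  let nu := ctype (restrict k (tab2 (ivl c r))) in
  [/\ k <= c -> nu = [:: k], c < k <= c + r -> nu = [:: c; k - c]
    & c + r < k -> nth 0 nu 0 + nth 0 nu 1 = c + r].
Proof.
move=> /andP[k_gt0 le_kn] pcr; rewrite /= /ctype reading_word_restrict reading_word_ivl //.
have [w1 w2 w3] := filter_interval_word k c r (n - c - r).
have c_gt0 : 0 < c by move: pcr; rewrite /interval_params; lia.
split=> le_k.
- by rewrite w1 //; have [-> //] := ctype_interval_word k_gt0 (leq0n k) (fun=> erefl 0).
- have le_kc : k - c <= c by move: pcr; rewrite /interval_params; lia.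
  rewrite w2 //; have [-> // _] := ctype_interval_word c_gt0 le_kc (fun=> erefl 0).
  by rewrite subn_gt0; case/andP: le_k => ->.
- have le_rc : r <= c by move: pcr; rewrite /interval_params; lia.
  have rq : r = 0 -> k - (c + r) = 0 by move: pcr; rewrite /interval_params; lia.
  rewrite w3; last by move: pcr; rewrite /interval_params; lia.
  by have [_ ->] := ctype_interval_word c_gt0 le_rc rq.
Qed.

(** If a + b > c + r, the first two parts of the type sum to c + r, too little to dominate.
    Otherwise the type has at most two parts, and only its first part is compared with a. *)
Lemma dominates_ctype2 a b c r : 0 < b <= a -> a + b <= n -> interval_params c r ->
  dominates (ctype (restrict (a + b) (tab2 (ivl c r)))) [:: a; b] =
  (a <= c) && (a + b <= c + r).
Proof.
move=> lt_ba le_abn pcr.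
have k_ok : 0 < a + b <= n by lia.
have [t1 t2 t3] := ctype_restrict_ivl k_ok pcr; move: t1 t2 t3 => /=.
set nu := ctype _ => t1 t2 t3.
have [le_kc | lt_ck] := leqP (a + b) c.
  rewrite t1 // /dominates /= !addn0 eqxx /=; lia.
have [le_k | lt_k] := leqP (a + b) (c + r); last first.
  rewrite andbF; apply/negbTE/negP => /andP[_ /allP all2].
  have lt2 : 2 \in iota 0 (maxn (size nu) (size [:: a; b])).+1.
    by rewrite mem_iota; apply: (leq_maxr (size nu) 2).
  by have := all2 2 lt2; rewrite !sumn_take2 t3 // [nth _ _ _]/= leqNgt lt_k.
by rewrite t2 ?lt_ck // /dominates /=; lia.
Qed.

Lemma dominates_ctype1 k : 0 < k <= n ->
  dominates (ctype (restrict k (tab2 (ivl n 0)))) [:: k].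
Proof.
move=> k_ok; have pn0 : interval_params n 0 by rewrite /interval_params !eqxx.
have /andP[_ le_kn] := k_ok; have [nuE _ _] := ctype_restrict_ivl k_ok pn0.
by rewrite nuE // /dominates /= !eqxx /= leqnn.
Qed.

End Tableaux.

(** * Standard tableaux, ballot sets and descents *)

Section StandardTableaux.
Variable n : nat.
Implicit Types (S T : tableau n) (Q : {set 'I_n}) (i : 'I_n).

Lemma zip_ltP x0 (s t : seq 'I_n) : size t <= size s ->
  reflect (forall j, j < size t -> nth x0 s j < nth x0 t j)
          (all (fun p : 'I_n * 'I_n => p.1 < p.2) (zip s t)).
Proof.
move=> le_ts; apply: (iffP (all_nthP (x0, x0))) => [ltz j ltj | lt_st j].
  have := ltz j; rewrite size_zip nth_zip_cond size_zip.
  have ltm : j < minn (size s) (size t) by rewrite (minn_idPr le_ts).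
  by rewrite ltm => /(_ isT).
rewrite size_zip nth_zip_cond size_zip => ltm; rewrite ltm /=; apply: lt_st.
by rewrite (minn_idPr le_ts) in ltm.
Qed.

Lemma find_row S j i : uniq (flatten S) -> i \in nth [::] S j -> row_of S i = j.
Proof.
rewrite /row_of; elim: S j => [|r S IHS] [|j] //=; first by move=> _ ->.
rewrite cat_uniq => /and3P[_ /hasPn nh uS] iS; rewrite (IHS j) // ifF //.
apply/negP => ir; have /nh : i \in flatten S.
  apply/flattenP; exists (nth [::] S j) => //; apply: mem_nth.
  by rewrite ltnNge; apply: contraL iS => le; rewrite nth_default.
by rewrite ir.
Qed.

Lemma syt_uniq S : is_syt S -> uniq (flatten S).
Proof. by case/and4P=> _ /perm_uniq -> _ _; apply: enum_uniq. Qed.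

Lemma syt_mem S i : is_syt S -> i \in flatten S.
Proof. by case/and4P=> _ /perm_mem -> _ _; rewrite mem_enum. Qed.

Lemma row_of_in S i : is_syt S -> i \in nth [::] S (row_of S i).
Proof.
move=> sytS; rewrite /row_of -[i \in _]/((fun r : seq 'I_n => i \in r) _); apply: nth_find.
have /flattenP[r rS ir] := syt_mem i sytS.
by apply/hasP; exists r.
Qed.

Lemma syt_shape_geq S j : is_syt S -> j.+1 < size S ->
  0 < size (nth [::] S j.+1) <= size (nth [::] S j).
Proof.
case/and4P=> /andP[/(sortedP 0) sh n0] _ _ _ ltj.
have := sh j; rewrite size_map => /(_ ltj); rewrite !(nth_map [::]) ?(ltnW ltj) // => le_sz.
apply/andP; split=> //; rewrite lt0n; apply: contraNneq n0 => sz0.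
by apply/mapP; exists (nth [::] S j.+1); rewrite ?sz0 // mem_nth.
Qed.

Lemma syt_row_below S i j : is_syt S -> row_of S i = j.+1 ->
  exists2 i' : 'I_n, i' < i & row_of S i' = j.
Proof.
move=> sytS rowi; have := row_of_in i sytS; rewrite rowi => iS.
have ltj : j.+1 < size S.
  by rewrite ltnNge; apply: contraL iS => le; rewrite nth_default.
have /andP[_ le_sz] := syt_shape_geq sytS ltj.
have lt_ix : index i (nth [::] S j.+1) < size (nth [::] S j.+1) by rewrite index_mem.
have /and4P[_ _ _ /(sortedP [::]) /(_ j ltj)] := sytS.
move/(zip_ltP i le_sz) => /(_ _ lt_ix); rewrite nth_index // => lt_i.
exists (nth i (nth [::] S j) (index i (nth [::] S j.+1))) => //.
by apply: find_row; [apply: syt_uniq | apply: mem_nth; apply: leq_trans le_sz].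
Qed.

Lemma syt_two_row T : 0 < n -> is_syt T -> size T <= 2 ->
  exists r0 r1, [/\ two_row T r0 r1, T = tab2 [set i in r1],
    sorted (fun i j : 'I_n => i < j) r0,
    r1 = enum [set i in r1] & forall q, q \in r1 -> partner r0 r1 q < q].
Proof.
move=> n_gt0 sytT le2; have uT := syt_uniq sytT.
have /and4P[shT permT sortT colT] := sytT.
case: T le2 shT permT sortT colT uT sytT => [|r0 [|r1 []]] //= _ shT permT sortT colT uT sytT.
- by have := perm_size permT; rewrite size_enum_ord /=; lia.
- move: permT sortT; rewrite cats0 andbT => permT sort0.
  exists r0, [::]; rewrite (_ : [set i in [::]] = set0); last by apply/setP=> i; rewrite !inE.
  split=> //; first by split; rewrite ?cats0.
    rewrite /tab2 eqxx; congr [:: _]; apply: (@irr_sorted_eq _ (fun i j : 'I_n => i < j)) => //.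
    - by move=> j i k; apply: ltn_trans.
    - by move=> i; apply: ltnn.
    - have : sorted ltn (map val (enum 'I_n)) by rewrite val_enum_ord iota_ltn_sorted.
      by rewrite sorted_map.
    - by apply: perm_mem.
  by rewrite (_ : enum set0 = [::]) //; apply/eqP; rewrite -size_eq0 -cardE cards0.
have /andP[r1_gt0 le_r10] := @syt_shape_geq [:: r0; r1] 0 sytT isT; rewrite /= in r1_gt0 le_r10.
case/and3P: sortT => sort0 sort1 _; rewrite cats0 in permT uT.
have tr : two_row [:: r0; r1] r0 r1 by split=> //; case: (r1) r1_gt0.
have r1E : r1 = enum [set i in r1] by apply: eq_enum_set => // i; rewrite inE.
exists r0, r1; split=> //.
  rewrite /tab2 ifF.
    rewrite -r1E; congr [:: _; _]; apply: eq_enum_set => // i.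
    by rewrite !inE (two_row_notin tr).
  apply/negbTE/set0Pn; case: (r1) r1_gt0 => // x s _.
  by exists x; rewrite !inE eqxx.
move=> q qr1; have lt_ix : index q r1 < size r1 by rewrite index_mem.
have := colT; rewrite andbT => /(zip_ltP q le_r10)/(_ _ lt_ix).
by rewrite nth_index.
Qed.

Lemma tab2_inj Q Q' : 0 < n -> tab2 Q = tab2 Q' -> Q = Q'.
Proof.
move=> n_gt0; rewrite /tab2.
case: eqVneq => [->|nQ]; case: eqVneq => [->|nQ'] // [_ eqQ].
by apply/setP=> i; rewrite -mem_enum eqQ mem_enum.
Qed.

Lemma second_row_tab2 Q : nth [::] (tab2 Q) 1 = enum Q.
Proof.
rewrite /tab2; case: eqP => [->|//] /=.
by apply/esym/eqP; rewrite -size_eq0 -cardE cards0.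
Qed.

Lemma shape_tab2 Q : shape (tab2 Q) = if #|Q| == 0 then [:: n] else [:: n - #|Q|; #|Q|].
Proof.
rewrite /tab2 cards_eq0; case: eqP => _; rewrite /shape /= ?size_enum_ord // -!cardE.
by rewrite [#|_|]cardsCs setCK card_ord.
Qed.

Lemma two_row_tab2 Q : #|Q| <= #|~: Q| -> two_row (tab2 Q)
  (if Q == set0 then enum 'I_n else enum (~: Q)) (enum Q).
Proof.
move=> leQ; have enum0 : enum (@set0 'I_n) = [::].
  by apply/eqP; rewrite -size_eq0 -cardE cards0.
rewrite /tab2; case: eqVneq => [->|nQ]; first by rewrite enum0; split; rewrite ?cats0.
split; last by rewrite -!cardE.
  case eqQ: (enum Q) => //; case/set0Pn: nQ => i.
  by rewrite -mem_enum eqQ.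
apply: uniq_perm; rewrite ?enum_uniq ?cat_uniq ?enum_uniq ?andbT //=.
  by apply/hasPn => i; rewrite !mem_enum inE negbK.
by move=> i; rewrite mem_cat !mem_enum inE orNb.
Qed.

Lemma count_enum_lt Q m : count (fun i : 'I_n => i < m) (enum Q) = #|[set i in Q | i < m]|.
Proof.
rewrite cardE -size_filter; apply: perm_size; apply: uniq_perm.
- exact/filter_uniq/enum_uniq.
- exact: enum_uniq.
by move=> i; rewrite mem_filter !mem_enum inE andbC.
Qed.

Lemma ballot_card Q : ballot Q -> #|Q| <= #|~: Q|.
Proof.
move=> /(_ n); have E (A : {set 'I_n}) : [set i in A | i < n] = A.
  by apply/setP=> i; rewrite inE ltn_ord andbT.
by rewrite !E.
Qed.

(** Otherwise the initial segment ending at the element of Q of index j holds j + 1 elements of Q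
    but at most j others. *)
Lemma ballot_column Q x0 j : ballot Q -> j < #|Q| ->
  nth x0 (enum (~: Q)) j < nth x0 (enum Q) j.
Proof.
move=> bal ltj; have le_c := ballot_card bal.
have tr : transitive (fun i j : 'I_n => i < j) by move=> a b c; apply: ltn_trans.
have lt_nth (A : {set 'I_n}) a b : a < b -> b < #|A| -> nth x0 (enum A) a < nth x0 (enum A) b.
  move=> ltab ltb; apply: (sorted_ltn_nth tr x0 (sorted_enum_set A)) => //; rewrite inE -cardE //.
  exact: ltn_trans ltb.
set q := nth x0 (enum Q) j; set p := nth x0 (enum (~: Q)) j.
rewrite ltnNge; apply/negP => le_qp.
have neq : p != q.
  have : p \in ~: Q by rewrite -mem_enum mem_nth // -cardE; apply: leq_trans le_c.
  by rewrite inE; apply: contraNneq => ->; rewrite -mem_enum mem_nth // -cardE.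
have lt_qp : q < p by rewrite ltn_neqAle eq_sym neq.
have := bal q.+1; rewrite -!count_enum_lt leqNgt => /negP; apply.
apply: (@leq_trans j.+1).
  rewrite -(cat_take_drop j (enum (~: Q))) count_cat ltnS -[leqRHS]addn0.
  apply: leq_add.
    by apply: leq_trans (count_size _ _) _; rewrite size_take; case: ltnP.
  rewrite leqn0 -[_ == 0]negbK -lt0n -has_count; apply/hasPn => i /(nthP x0)[l].
  rewrite size_drop nth_drop -cardE => ltl <-; rewrite -leqNgt.
  apply: leq_trans lt_qp _; rewrite /p; case: l ltl => [|l] ltl; first by rewrite addn0.
  by apply/ltnW/lt_nth; lia.
rewrite -(cat_take_drop j.+1 (enum Q)) count_cat; apply: leq_trans (leq_addr _ _).
have sz : size (take j.+1 (enum Q)) = j.+1 by rewrite size_takel // -cardE.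
suff : all (fun i : 'I_n => i < q.+1) (take j.+1 (enum Q)).
  by rewrite all_count => /eqP ->; rewrite sz.
apply/(all_nthP x0) => l; rewrite sz => ltl.
rewrite nth_take // ltnS; move: ltl; rewrite ltnS leq_eqVlt.
case/orP=> [/eqP-> | ltlj]; first exact: leqnn.
by apply/ltnW/lt_nth.
Qed.

Lemma ballot_syt Q : 0 < n -> ballot Q -> is_syt (tab2 Q).
Proof.
move=> n_gt0 bal; have leQ := ballot_card bal.
have [_ permQ _] := two_row_tab2 leQ.
apply/and4P; split.
- rewrite shape_tab2; case: eqP => [_|/eqP Q0]; first by rewrite /is_part /= inE; lia.
  have -> : n - #|Q| = #|~: Q| by rewrite [#|~: Q|]cardsCs setCK card_ord.
  move: leQ Q0; move: #|~: Q| #|Q| => x y le_yx y0.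
  by rewrite /is_part /= !inE; lia.
- move: permQ; rewrite /tab2; case: eqVneq => [->|_] /=; last by rewrite cats0.
  by rewrite !cats0.
- rewrite /tab2; case: eqP => _; rewrite /= ?sorted_enum_set ?andbT //.
  have : sorted ltn (map val (enum 'I_n)) by rewrite val_enum_ord iota_ltn_sorted.
  by rewrite sorted_map.
rewrite /tab2; case: eqP => //= _; rewrite andbT.
apply/(zip_ltP (Ordinal n_gt0)); first by rewrite -!cardE.
by move=> j; rewrite -cardE => /ballot_column; apply.
Qed.

Lemma row_of_tab2 Q i : #|Q| <= #|~: Q| -> row_of (tab2 Q) i = (i \in Q).
Proof. by move=> /two_row_tab2/row_of_two_row->; rewrite mem_enum. Qed.

Lemma card_ivl c r : c + r <= n -> #|ivl n c r| = r.
Proof. by move=> le_crn; rewrite cardE -(size_map val) val_enum_ivl // size_iota. Qed.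

(** Subtracting c injects the interval into the entries before it, because r <= c. *)
Lemma ballot_ivl c r : interval_params n c r -> ballot (ivl n c r).
Proof.
move=> pcr m; have le_rc : r <= c by move: pcr; rewrite /interval_params; lia.
have lt_n i : i - c < n by have := ltn_ord i; lia.
pose f i := Ordinal (lt_n i).
rewrite -(card_in_imset (f := f)) => [|i j]; last first.
  rewrite !inE => /andP[/andP[ci _] _] /andP[/andP[cj _] _] /(congr1 val) /= eqf.
  by apply/val_inj => /=; lia.
apply/subset_leq_card/subsetP=> _ /imsetP[i + ->]; rewrite !inE /=; lia.
Qed.

Lemma ivl_cardC c r : interval_params n c r -> #|ivl n c r| <= #|~: ivl n c r|.
Proof. by move/ballot_ivl/ballot_card. Qed.

Lemma des_ivl c r : 0 < n -> interval_params n c r -> des (tab2 (ivl n c r)) = (0 < r).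
Proof.
move=> n_gt0 pcr; have le_c := ivl_cardC pcr.
rewrite /des; set X := [set p | _].
have XE (p : 'I_n * 'I_n) : (p \in X) =
    [&& 0 < r, p.2 == c :> nat & p.2 == p.1.+1 :> nat].
  rewrite inE !row_of_tab2 // !inE; move: pcr; rewrite /interval_params.
  have := ltn_ord p.1; have := ltn_ord p.2; lia.
case: r pcr le_c @X XE => [|r] pcr le_c X XE.
  by apply: eq_card0 => p; rewrite XE.
have lt1 : c.-1 < n by move: pcr; rewrite /interval_params; lia.
have lt2 : c < n by move: pcr; rewrite /interval_params; lia.
rewrite (_ : X = [set (Ordinal lt1, Ordinal lt2)]) ?cards1 //; apply/setP=> -[p1 p2].
rewrite XE !inE xpair_eqE -!val_eqE /=.
by move: pcr; rewrite /interval_params; lia.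
Qed.

Lemma syt_low_des S : 0 < n -> is_syt S -> des S < 2 ->
  exists c r, interval_params n c r /\ S = tab2 (ivl n c r).
Proof.
move=> n_gt0 sytS; rewrite /des ltnS => /card_le1P desS.
have des_eq (i j i' j' : 'I_n) : j = i.+1 :> nat -> row_of S i < row_of S j ->
    j' = i'.+1 :> nat -> row_of S i' < row_of S j' -> j = j'.
  move=> eq_j lt_ij eq_j' lt_ij'.
  have ij : (i, j) \in
      [set p : 'I_n * 'I_n | (p.2 == p.1.+1 :> nat) && (row_of S p.1 < row_of S p.2)].
    by rewrite inE /= eq_j eqxx.
  have := desS _ ij (i', j'); rewrite !inE /= eq_j' eqxx lt_ij' => /esym/eqP.
  by case.
have pred_of (i : 'I_n) m : row_of S i = m.+1 -> exists i' : 'I_n, i = i'.+1 :> nat.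
  case/(syt_row_below sytS) => i' lt_i' _.
  have lt_n : i.-1 < n by have := ltn_ord i; lia.
  by exists (Ordinal lt_n) => /=; lia.
have ltrow j : j < size S -> exists i, row_of S i = j.
  case: j => [|j] ltj.
    case/and4P: (sytS) => /andP[_ n0] _ _ _.
    have : nth [::] S 0 != [::].
      apply: contraNneq n0 => S0; apply/mapP; exists (nth [::] S 0); rewrite ?S0 //.
      by rewrite -S0 mem_nth.
    case E: (nth [::] S 0) => [//|x s] _; exists x; apply: find_row (syt_uniq sytS) _.
    by rewrite E inE eqxx.
  have /andP[] := syt_shape_geq sytS ltj.
  case E: (nth [::] S j.+1) => [//|x s] _ _; exists x; apply: find_row (syt_uniq sytS) _.
  by rewrite E inE eqxx.
(* The smallest entry above row m creates a descent, since its predecessor lies in row m or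
   lower. *)
have first_above m : m.+1 < size S -> exists u : 'I_n,
    [/\ m < row_of S u, (forall i, m < row_of S i -> u <= i) &
      exists2 u' : 'I_n, u = u'.+1 :> nat & row_of S u' <= m].
  move=> /ltrow[i0 row0].
  have P0 : m < row_of S i0 by rewrite row0.
  case: (@arg_minnP _ i0 (fun i => m < row_of S i) (fun i : 'I_n => val i) P0) => u Pu minu.
  exists u; split=> //.
  case rowu: (row_of S u) Pu => [//|j] _; have [u' eq_u] := pred_of u j rowu.
  exists u' => //; rewrite leqNgt; apply/negP => /minu /=; rewrite eq_u; lia.
(* With a third row, the first entry w above row 1 has a smaller entry below it outside the bottom
   row, so m = 0 and m = 1 give different descents. *)
have le2 : size S <= 2.
  rewrite leqNgt; apply/negP => lt2.
  have [u [lt_u minu [u' eq_u le_u']]] := first_above 0 (ltnW lt2).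
  have [w [lt_w minw [w' eq_w le_w']]] := first_above 1 lt2.
  have uw : u = w.
    apply: (des_eq u' u w' w) => //; first by apply: leq_ltn_trans lt_u.
    by apply: leq_ltn_trans lt_w.
  have : row_of S w = (row_of S w).-1.+1 by lia.
  case/(syt_row_below sytS) => v lt_vw rowv.
  have : u <= v by apply: minu; lia.
  by rewrite uw leqNgt lt_vw.
have [r0 [r1 [tr SE sort0 r1E ltp]]] := syt_two_row n_gt0 sytS le2.
have rowE i : row_of S i = (i \in r1) by rewrite (row_of_two_row tr).
have [r1_nil|] := eqVneq r1 [::].
  exists n, 0; split; first by rewrite /interval_params !eqxx.
  rewrite SE; congr tab2; apply/setP=> i; rewrite !inE r1_nil in_nil.
  by rewrite leqNgt ltn_ord.
move=> r1_n; have [i0 i0r] : exists i, i \in r1.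
  by case: (r1) r1_n => // x s _; exists x; rewrite inE eqxx.
case: (@arg_minnP _ i0 (fun i => i \in r1) (fun i : 'I_n => val i) i0r) => c cr1 minc.
case: (@arg_maxnP _ i0 (fun i => i \in r1) (fun i : 'I_n => val i) i0r) => M Mr1 maxM.
have [c' eq_c] : exists c' : 'I_n, c = c'.+1 :> nat.
  by apply: (pred_of c 0); rewrite rowE cr1.
have c'N : c' \notin r1 by apply/negP => /minc /=; rewrite eq_c ltnn.
(* A gap in the second row after c would start a second descent. *)
have prev (x y : 'I_n) : x \in r1 -> c < x -> x = y.+1 :> nat -> y \in r1.
  move=> xr1 lt_cx eq_x; apply: contraT => yN.
  have := des_eq y x c' c eq_x; rewrite !rowE (negPf yN) (negPf c'N) xr1 cr1.
  by move=> /(_ isT eq_c isT) xc; rewrite xc ltnn in lt_cx.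
have fill m (i : 'I_n) : M - m = i -> c <= i <= M -> i \in r1.
  elim: m i => [|m IHm] i; first by rewrite subn0 => eqi _; rewrite -(val_inj eqi).
  move=> eqi /andP[le_ci le_iM]; have lt_i1 : M - m < n by have := ltn_ord M; lia.
  have [lt_mM|le_Mm] := ltnP m M.
    apply: (prev (Ordinal lt_i1) i); rewrite /=; try lia.
    by apply: IHm => //=; lia.
  by apply: IHm; lia.
have Qivl : [set i in r1] = ivl n c (M.+1 - c).
  apply/setP=> i; rewrite !inE; apply/idP/idP => [ir1|/andP[le_ci lt_i]].
    by have /= := minc i ir1; have /= := maxM i ir1; have /= := minc M Mr1; lia.
  by apply: (fill (M - i) i); lia.
exists (nat_of_ord c), (M.+1 - c); split; last by rewrite SE Qivl.
have le_cM : c <= M by apply: minc.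
have le_n : c + (M.+1 - c) <= n by have := ltn_ord M; lia.
rewrite /interval_params le_n andbT; apply/orP; right; apply/andP; split; first by lia.
have sz1 : size r1 = M.+1 - c by rewrite r1E -cardE Qivl card_ivl.
have [_ _ le_sz] := tr.
have nth_ge j : j < size r0 -> j <= nth c r0 j.
  elim: j => // j IHj ltj; apply: leq_ltn_trans (IHj (ltnW ltj)) _.
  by have /(sortedP c)/(_ j ltj) := sort0.
have lt_last : (M.+1 - c).-1 < size r1 by lia.
have last_in : nth c r1 (M.+1 - c).-1 \in r1 by apply: mem_nth.
have uniq_r1 : uniq r1 by rewrite r1E enum_uniq.
(* For the bound r <= c: the entry below the last one of the second row has index r - 1 in the
   increasing first row, so it is at least r - 1, and it is less than c because it avoids the
   interval. *)
have := ltp _ last_in; rewrite /partner index_uniq // (set_nth_default c) ?(leq_trans lt_last) //.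
have pin : nth c r0 (M.+1 - c).-1 \in r0 by apply: mem_nth; apply: leq_trans le_sz.
have := nth_ge (M.+1 - c).-1 (leq_trans lt_last le_sz).
rewrite (two_row_notin tr) in pin; have leM : nth c r1 (M.+1 - c).-1 <= M := maxM _ last_in.
move: pin leM; set p := nth c r0 _; set q := nth c r1 _ => pin leM le_p lt_pq.
have lt_pc : p < c.
  rewrite ltnNge; apply: contra pin => le_cp.
  have le_pM : p <= M by apply: leq_trans leM; apply: ltnW.
  by apply: (fill (M - p) p); rewrite ?subKn ?le_cp.
by move: (leq_ltn_trans le_p lt_pc); clear; lia.
Qed.

End StandardTableaux.

(** * The index set in terms of rank and degree *)

Section SigmaIndex.
Variable n : nat.

(** The entries from c on have label 1, so the cocharge monomial has degree n - c. For r = 0 all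
    labels are 0 and the degree comes from mu. *)
Definition start_of r d := if r == 0 then n else n - d.

(* The only pair in Sigma that contributes a copy of V_(n-r,r) in degree d. *)
Definition sigma_index r d : tableau n * seq nat :=
  (tab2 (ivl n (start_of r d) r), nseq (if r == 0 then d else 0) 1).

Lemma start_of_params r d : r <= d -> d + r <= n -> interval_params n (start_of r d) r.
Proof. by move=> le_rd le_drn; rewrite /interval_params /start_of; case: eqP; lia. Qed.

Lemma part_le0 mu : is_part mu -> nth 0 mu 0 <= 0 -> mu = [::].
Proof. by case: mu => [|[|x] mu] //; rewrite /is_part inE andbF. Qed.

Lemma part_le1 mu : is_part mu -> nth 0 mu 0 <= 1 -> mu = nseq (size mu) 1.
Proof.
elim: mu => [//|x mu IHmu] /andP[sorted_mu]; rewrite inE negb_or => /andP[x0 mu0] /= x1.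
have -> : x = 1 by lia.
congr (_ :: _); apply: IHmu; first by rewrite /is_part mu0 (path_sorted sorted_mu).
by case: mu sorted_mu {mu0} => [|y mu] //= /andP[]; lia.
Qed.

Lemma is_part_nseq1 m : is_part (nseq m 1).
Proof.
rewrite /is_part mem_nseq andbF andbT.
by case: m => //= m; elim: m => //= m ->.
Qed.

Hypothesis n_gt0 : 0 < n.

(** One descent forces mu to be empty; without descents mu is a column of ones, whose polynomial is
    a single e_d. *)
Lemma SigmaE2 a b S mu : 0 < b <= a -> a + b <= n ->
  Sigma [:: a; b] 2 (S, mu) <-> exists r d, Lambda2 n a b r d /\ (S, mu) = sigma_index r d.
Proof.
move=> lt_ba le_abn; rewrite /Sigma /= addn0; split.
  case/and5P=> sytS domS desS part_mu /andP[sz_mu mu0].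
  have [c [r [pcr SE]]] := syt_low_des n_gt0 sytS desS.
  move: domS mu0; rewrite SE dominates_ctype2 // des_ivl // => /andP[le_ac le_k] mu0.
  have [r0 | r_gt0] := posnP r.
    exists 0, (size mu); split; first by rewrite /Lambda2; lia.
    rewrite /sigma_index /start_of /=; congr (tab2 _, _); last first.
      by apply: part_le1 => //; move: mu0; rewrite r0.
    by apply/setP=> i; rewrite !inE r0; lia.
  move: mu0; rewrite r_gt0 => /(part_le0 part_mu)->.
  exists r, (n - c); move: pcr; rewrite /interval_params => pcr.
  split; first by rewrite /Lambda2; lia.
  by rewrite /sigma_index /start_of !ifF ?subKn; try lia.
move=> [r [d [L [-> ->]]]]; move: L; rewrite /Lambda2 => L.
have pcr : interval_params n (start_of r d) r by apply: start_of_params; lia.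
rewrite ballot_syt ?dominates_ctype2 ?des_ivl ?is_part_nseq1 ?size_nseq //; last exact: ballot_ivl.
rewrite /start_of; case: eqP => [r0|nr0] /=; rewrite ?nth_nseq; last by lia.
by case: ifP; lia.
Qed.

Lemma SigmaE1 k S mu : 0 < k <= n ->
  Sigma [:: k] 1 (S, mu) <-> exists r d, Lambda1 r d /\ (S, mu) = sigma_index r d.
Proof.
move=> k_ok; rewrite /Sigma /= addn0; split.
  case/and5P=> sytS _ desS part_mu /andP[_ mu0].
  have [c [r [pcr SE]]] := syt_low_des n_gt0 sytS (ltnW desS).
  exists 0, 0; split=> //; rewrite /sigma_index /start_of /=.
  have r0 : r = 0 by move: desS; rewrite SE des_ivl //; lia.
  rewrite (part_le0 part_mu); last by apply: leq_trans mu0 _; rewrite leq_subLR; lia.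
  by congr (_, _); rewrite SE; congr tab2; apply/setP=> i; rewrite !inE r0; lia.
move=> [r [d [/andP[/eqP-> /eqP->]]]]; rewrite /sigma_index /start_of /= => -[-> ->].
have pn0 : interval_params n n 0 by rewrite /interval_params !eqxx.
by rewrite ballot_syt ?dominates_ctype1 ?des_ivl //; apply: ballot_ivl.
Qed.

End SigmaIndex.

(** * The basis *)

Local Open Scope ring_scope.

Lemma e_poly_nseq n la m : (m <= n - sumn la)%N -> e_poly n la (nseq m 1%N) = mesym n rat m.
Proof.
move=> le_m; rewrite /e_poly.
have expE j : part_exp (nseq m 1%N) j = (j.+1 == m).
  by rewrite /part_exp !nth_nseq; do 2!case: ifP; lia.
case: m le_m expE => [|m] le_m expE.
  by rewrite mesym0E big1 // => j _; rewrite expE.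
rewrite (bigD1 (Ordinal le_m)) //= expE eqxx big1 ?mulr1 // => j.
by rewrite expE eqSS -val_eqE /= => /negPf->.
Qed.

(** * Spans modulo a subspace *)

Section SpanMod.
Variables (V : lmodType rat) (J : V -> Prop) (I : eqType) (P : pred I) (F : I -> V).
Hypotheses (J0 : J 0) (JD : forall u v, J u -> J v -> J (u + v)).
Hypothesis JZ : forall c v, J v -> J (c *: v).

Lemma span_mod_J v : J v -> in_span_mod J P F v.
Proof. by move=> Jv; exists [::], (fun=> 0); rewrite big_nil subr0. Qed.

Lemma span_modD u v : in_span_mod J P F u -> in_span_mod J P F v -> in_span_mod J P F (u + v).
Proof.
move=> [r1 [c1 [Pr1 J1]]] [r2 [c2 [Pr2 J2]]].
(* Coefficients depend on the index alone and the lists may repeat it, so multiplicities go into the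
   coefficients. *)
exists (undup (r1 ++ r2)), (fun i => c1 i *+ count_mem i r1 + c2 i *+ count_mem i r2).
split; first by apply/allP=> i; rewrite mem_undup mem_cat => /orP[/(allP Pr1)|/(allP Pr2)].
have sumE (r r' : seq I) (c : I -> rat) : {subset r <= r'} ->
    \sum_(i <- r) c i *: F i = \sum_(i <- undup r') (c i *+ count_mem i r) *: F i.
  move=> sub; rewrite -big_undup_iterop_count [RHS](bigID [in r]) /=.
  rewrite [X in _ = _ + X]big1 ?addr0 => [|i ir]; last first.
    by rewrite (count_memPn ir) mulr0n scale0r.
  rewrite -[RHS]big_filter; apply: etrans (perm_big _ _).
    by apply: eq_bigr => i _; rewrite -scalerMnl.
  apply: uniq_perm; rewrite ?filter_uniq ?undup_uniq //.
  by move=> i; rewrite mem_filter !mem_undup; apply/idP/andP => [ir|[]//]; split=> //; apply: sub.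
rewrite (eq_bigr _ (fun i _ => scalerDl (F i) _ _)) big_split /=.
rewrite -!sumE; try by move=> i ir; rewrite mem_cat ir ?orbT.
by rewrite opprD addrACA; apply: JD.
Qed.

Lemma span_mod_elt c i : P i -> in_span_mod J P F (c *: F i).
Proof.
by move=> Pi; exists [:: i], (fun=> c); rewrite big_seq1 subrr /= Pi.
Qed.

End SpanMod.

Definition second_set n (T : tableau n) : {set 'I_n} := [set i in nth [::] T 1].

Lemma second_set_tab2 n (Q : {set 'I_n}) : second_set (tab2 Q) = Q.
Proof. by apply/setP=> i; rewrite inE second_row_tab2 mem_enum. Qed.

Lemma polytab_syt n (T : tableau n) : (0 < n)%N -> is_syt T -> (size T <= 2)%N ->
  let Q := second_set T in
  [/\ T = tab2 Q, homdeg #|Q| (polytab T Q), down setT (polytab T Q) = 0,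
      polytab T Q Q = 1 & forall A, polytab T Q A != 0 -> (weight A <= weight Q)%N].
Proof.
move=> n_gt0 sytT le2; have [r0 [r1 [tr TE _ r1E ltp]]] := syt_two_row n_gt0 sytT le2.
have QE : second_set T = [set i in r1].
  by rewrite {1}TE second_set_tab2.
rewrite QE /=; have [lead1 lead2] := polytab_lead tr ltp.
by split=> //; [exact: homdeg_polytab | exact: (down_polytab tr)].
Qed.

Lemma syt_tab2_sizes n (T : tableau n) : (0 < n)%N -> is_syt T -> (size T <= 2)%N ->
  exists r0 r1, two_row T r0 r1 /\ [set i in r1] = second_set T.
Proof.
move=> n_gt0 sytT le2; have [r0 [r1 [tr TE _ r1E ltp]]] := syt_two_row n_gt0 sytT le2.
by exists r0, r1; split=> //; rewrite TE second_set_tab2.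
Qed.

Lemma size_tab2 n (Q : {set 'I_n}) : (size (tab2 Q) <= 2)%N.
Proof. by rewrite /tab2; case: ifP. Qed.

(** * Comparison with the Specht module *)

Section Specht.
Variable n : nat.
Implicit Types (f : tabloid n) (v : tabmod n).

Definition ones f : {set 'I_n} := [set i | f i == 1%N :> nat].

Definition tabset v : sqfree n := \sum_f (v f : rat) *: delta (ones f).

Fact tabset_linear : linear tabset.
Proof.
move=> c u v; rewrite /tabset scaler_sumr -big_split /=; apply: eq_bigr => f _.
by rewrite !ffunE scalerDl scalerA.
Qed.
HB.instance Definition _ :=
  GRing.isLinear.Build rat (tabmod n) (sqfree n) _ tabset tabset_linear.

(** Sends a tabloid to the monomial of its second row times e_1^j; equivariant because e_1 is
    symmetric. *)
Definition specht_map j v : {mpoly rat[n]} :=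
  linform setT ^+ j * \sum_f (v f : rat) *: 'X_[mnm_set (ones f)].

Fact specht_map_linear j : linear (specht_map j).
Proof.
move=> c u v; rewrite /specht_map scalerAr -mulrDr scaler_sumr -big_split /=.
congr (_ * _); apply: eq_bigr => f _.
by rewrite !ffunE scalerDl scalerA.
Qed.
HB.instance Definition _ j :=
  GRing.isLinear.Build rat (tabmod n) {mpoly rat[n]} _ (specht_map j) (specht_map_linear j).

Lemma sfpart_specht_map j v : sfpart (specht_map j v) = iter j (up setT) (tabset v).
Proof.
rewrite /specht_map mulrC sfpartM_linformX linear_sum; congr (iter j _ _).
by apply: eq_bigr => f _; rewrite linearZ /= sfpartX.
Qed.

Lemma act_tabloidK (t : 'S_n) f : act_tabloid t^-1%g (act_tabloid t f) = f.
Proof. by apply/ffunP=> i; rewrite !ffunE invgK permK. Qed.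

Lemma ones_act (t : 'S_n) f : ones (act_tabloid t f) = t @: ones f.
Proof.
apply/setP=> i; rewrite -[i in RHS](permKV t) mem_imset; last exact: perm_inj.
by rewrite !inE ffunE.
Qed.

Lemma specht_map_act j (t : 'S_n) v :
  specht_map j (act_tabmod t v) = msym t (specht_map j v).
Proof.
rewrite /specht_map msymM rmorphXn /= msym_linform; congr (_ * _).
rewrite linear_sum /= (reindex (act_tabloid t)) /=; last first.
  exists (act_tabloid t^-1%g) => f _; first exact: act_tabloidK.
  by have := act_tabloidK t^-1%g f; rewrite invgK.
apply: eq_bigr => f _; rewrite linearZ /= ffunE act_tabloidK; congr (_ *: _).
rewrite msymX; congr 'X_[_]; apply/mnmP=> i; rewrite !mnmE ones_act.
by rewrite -[i in LHS](permKV t) mem_imset //; apply: perm_inj.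
Qed.

Lemma tabset_tabvec f : tabset (tabvec f) = delta (ones f).
Proof.
rewrite /tabset (bigD1 f) //= big1 ?addr0 => [|g /negPf ne]; rewrite ffunE ?ne ?scale0r //.
by rewrite eqxx scale1r.
Qed.

Lemma ones_two_row (T : tableau n) r0 r1 : two_row T r0 r1 ->
  ones (tabloid_of T) = [set i in r1].
Proof.
move=> tr; apply/setP=> i; rewrite !inE ffunE (row_of_two_row tr) inordK.
  by case: (i \in r1).
by have := ltn_ord i; case: (i \in r1); lia.
Qed.

Lemma tabset_polytabloid (T : tableau n) r0 r1 : two_row T r0 r1 ->
  tabset (polytabloid T) = polytab T [set i in r1].
Proof.
move=> tr; rewrite /polytabloid linear_sum; apply: eq_bigr => tau _.
by rewrite linearZ /= tabset_tabvec ones_act (ones_two_row tr).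
Qed.

Lemma specht_ind rho (X : tabmod n -> Prop) :
    X 0 -> (forall u v, X u -> X v -> X (u + v)) -> (forall c v, X v -> X (c *: v)) ->
    (forall t : 'S_n, X (polytabloid (reshape rho (codom t)))) ->
  forall v, v \in specht n rho -> X v.
Proof.
move=> X0 XD XZ Xp v; rewrite /specht span_def big_map.
elim: (enum_mem _) v => [|t ts IHts] v; first by rewrite big_nil memv0 => /eqP->.
rewrite big_cons => /memv_addP[u /vlineP[c ->] [w wts ->]].
by apply: XD; [apply: XZ; apply: Xp | apply: IHts].
Qed.

Lemma reshape_two_row r (t : 'S_n) : (r <= n - r)%N ->
  exists r0 r1, two_row (reshape (if r == 0%N then [:: n] else [:: (n - r)%N; r]) (codom t)) r0 r1 /\
    size r1 = r.
Proof.
move=> le_r; have szt : size (codom t) = n by rewrite size_codom card_ord.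
have permt : perm_eq (codom t) (enum 'I_n).
  apply: uniq_perm; rewrite ?enum_uniq //.
    by rewrite map_inj_uniq ?enum_uniq //; apply: perm_inj.
  by move=> i; rewrite mem_enum inE -[i](permKV t) codom_f.
exists (take (n - r) (codom t)), (drop (n - r) (codom t)).
have sz1 : size (drop (n - r) (codom t)) = r by rewrite size_drop szt; lia.
split=> //; split; last by rewrite sz1 size_takel ?szt // leq_subr.
  case: eqP sz1 => [->|/eqP r_n0] sz1.
    by rewrite subn0 drop_oversize ?szt //= take_oversize ?szt.
  rewrite /= [take r _]take_oversize ?sz1 //.
  by case: drop sz1 => // /esym/eqP; rewrite (negPf r_n0).
by rewrite cat_take_drop.
Qed.

Lemma syt_reshape (T : tableau n) : (0 < n)%N -> is_syt T ->
  exists t : 'S_n, T = reshape (shape T) (codom t).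
Proof.
move=> n_gt0 sytT; have uT := syt_uniq sytT; have /and4P[_ permT _ _] := sytT.
have szT : size (flatten T) = n by rewrite (perm_size permT) size_enum_ord.
pose x0 := Ordinal n_gt0; pose g (i : 'I_n) := nth x0 (flatten T) i.
have g_inj : injective g.
  by move=> i j /eqP; rewrite nth_uniq ?szT // => /eqP/val_inj.
exists (perm g_inj); rewrite -[LHS]flattenK; congr reshape.
rewrite /codom /image_mem (eq_map (permE g_inj)).
rewrite (_ : map g _ = map (nth x0 (flatten T)) (map val (enum 'I_n))); last first.
  by rewrite -map_comp.
by rewrite val_enum_ord; have := mkseq_nth x0 (flatten T); rewrite szT => /esym.
Qed.

End Specht.

(** * From the adapted subspace to the higher Specht basis *)

Section Main.
Variables (n s : nat) (la : seq nat) (Lam : nat -> nat -> bool) (K : sqfree n -> Prop).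
Hypothesis n_gt0 : (0 < n)%N.
Hypothesis adaptedK : adapted la s Lam K.
Hypothesis LamP : forall r d, Lam r d ->
  [/\ (r <= d)%N, (d + r <= n)%N & r = 0%N -> (d <= n - sumn la)%N].
Hypothesis SigmaP : forall (S : tableau n) mu,
  Sigma la s (S, mu) <-> exists r d, Lam r d /\ (S, mu) = sigma_index n r d.

Local Notation U := (@up n setT).
Local Notation D := (@down n setT).
Local Notation J := (@I_ideal n la s).
Local Notation cindex := ((tableau n * seq nat) * tableau n)%type.
Implicit Types (q : cindex).

Definition deg_of q : nat := (sumn (flatten (cc_tableau q.1.1)) + size q.1.2)%N.
Definition rank_of q : nat := #|second_set q.2|.

Lemma ideal_eqP p p' : sfpart p = sfpart p' -> J (p - p').
Proof.
case: adaptedK => JK _ _ eqp; apply/JK; rewrite linearB /= eqp subrr.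
by have /JK := @I_ideal0 n la s; rewrite linear0.
Qed.

Lemma deg_sigma_index r d (T : tableau n) : Lam r d -> deg_of (sigma_index n r d, T) = d.
Proof.
move=> L; have [le_rd le_drn _] := LamP L.
rewrite /deg_of /= flatten_cc_ivl //; last exact: start_of_params.
by rewrite sumn_cat !sumn_nseq size_nseq /start_of; case: eqP => r0; lia.
Qed.

Lemma C_indexP q : C_index la s q ->
  [/\ Lam (rank_of q) (deg_of q), q.1 = sigma_index n (rank_of q) (deg_of q),
      is_syt q.2 & (size q.2 <= 2)%N].
Proof.
case: q => [[S mu] T] /and3P[/= /SigmaP[r [d [L Emu]]] sytT /eqP shT].
have [le_rd le_drn _] := LamP L.
have SE : S = tab2 (ivl n (start_of n r d) r) by case: Emu.
have le2 : (size T <= 2)%N.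
  by rewrite -(size_map size T) -/(shape T) shT /shape size_map SE size_tab2.
have [TE _ _ _ _] := polytab_syt n_gt0 sytT le2.
have pcr := start_of_params le_rd le_drn.
have rE : #|second_set T| = r.
  have cr : #|ivl n (start_of n r d) r| = r.
    by apply: card_ivl; move: pcr; rewrite /interval_params; lia.
  move: shT; rewrite SE {1}TE !shape_tab2 cr.
  by do 2!case: eqP => [->|_] //; case.
by rewrite /rank_of /= rE Emu deg_sigma_index.
Qed.

Lemma C_index_tab2 r d Q : Lam r d -> ballot Q -> #|Q| = r ->
  C_index la s (sigma_index n r d, tab2 Q).
Proof.
move=> L bal cardQ; have [le_rd le_drn _] := LamP L.
apply/and3P; split; first by apply/SigmaP; exists r, d.
  exact: ballot_syt.
rewrite /= !shape_tab2 cardQ card_ivl //.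
by have := start_of_params le_rd le_drn; rewrite /interval_params; lia.
Qed.

(** For r > 0 the elementary factor is 1 and [sfpart_F_poly] suffices. For r = 0 the factor F is a
    nonzero constant modulo squares, and e_d supplies U^d / d!. *)
Lemma sfpart_C_elt q : C_index la s q -> exists2 kappa : rat, kappa != 0 &
  sfpart (C_elt la q) =
    kappa *: iter (deg_of q - rank_of q) U (polytab q.2 (second_set q.2)).
Proof.
move=> /C_indexP[L q1E sytT le2]; have [le_rd le_drn le_dN] := LamP L.
have [TE homP DP lead1 _] := polytab_syt n_gt0 sytT le2.
have [r0 [r1 [tr QE]]] := syt_tab2_sizes n_gt0 sytT le2.
rewrite /C_elt q1E /sigma_index /=.
move: L le_rd le_drn le_dN; set r := rank_of q; set d := deg_of q => L le_rd le_drn le_dN.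
have pcr := start_of_params le_rd le_drn.
have [||kappa k0 sfF] := sfpart_F_poly tr
  (S := tab2 (ivl n (start_of n r d) r)) (c := start_of n r d).
- exact: flatten_cc_ivl.
- by rewrite QE -/(rank_of q) -/r; move: pcr; rewrite /interval_params; lia.
rewrite QE -/(rank_of q) -/r in sfF.
move: sfF; rewrite /start_of; case: eqP => [r_0|/eqP r_n0] sfF; last first.
  exists kappa => //; rewrite (e_poly_nseq (m := 0)) // mesym0E mulr1 sfF.
  by rewrite (_ : (n - (n - d) - r = d - r)%N) //; lia.
rewrite subnn sub0n r_0 /= in sfF.
have Q0 : second_set q.2 = set0 by apply/eqP; rewrite -cards_eq0 -/(rank_of q) -/r r_0.
have P0 : polytab q.2 (second_set q.2) = delta set0.
  apply/ffunP=> A; rewrite ffunE; case: eqVneq => [->|nA]; first by rewrite -Q0 lead1.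
  apply/eqP; apply: contraT => /homP; rewrite Q0 cards0 => /eqP.
  by rewrite cards_eq0 (negPf nA).
exists (kappa / d`!%:R).
  by rewrite mulf_neq0 // invr_eq0 pnatr_eq0 -lt0n fact_gt0.
rewrite e_poly_nseq ?le_dN // r_0 subn0.
rewrite (sfpartM_eq (p' := kappa%:MP)); last first.
  by rewrite sfF P0 -[kappa%:MP]mulr1 mul_mpolyC linearZ /= sfpart1.
by rewrite mul_mpolyC linearZ /= sfpart_mesym P0 scalerA.
Qed.

(** Each piece U^j h of the squarefree part lies in the ideal if [Lam] fails; otherwise h is
    expanded in Specht polynomials of standard tableaux. *)
Lemma span_modC p : in_span_mod J (C_index la s) (C_elt la) p.
Proof.
have [JK highK _] := adaptedK.
pose X v := forall p, sfpart p = v -> in_span_mod J (C_index la s) (C_elt la) p.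
have JD := @I_idealD n la s.
have congrX p1 p2 : sfpart p1 = sfpart p2 ->
    in_span_mod J (C_index la s) (C_elt la) p2 -> in_span_mod J (C_index la s) (C_elt la) p1.
  move=> eq12 sp2; rewrite -[p1](subrK p2); apply: span_modD => //.
  exact/span_mod_J/ideal_eqP.
have X0 : X 0.
  move=> p0 sf0; apply: span_mod_J; rewrite -[p0]subr0; apply: ideal_eqP.
  by rewrite sf0 linear0.
have XD u v : X u -> X v -> X (u + v).
  move=> Xu Xv p0 sfp; apply: (@congrX _ (sflift u + sflift v)).
    by rewrite linearD /= !sfliftK.
  by apply: span_modD => //; [apply: Xu | apply: Xv]; rewrite sfliftK.
suff : X (sfpart p) by apply.
rewrite (sum_proj (sfpart p)); apply: big_ind => // d _.
apply: (@hom_decomp _ d _ X X0 XD _ (@hom_proj _ d (sfpart p))) => r j h eq_d hh Dh.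
have [L | nL] := boolP (Lam r d); last first.
  move=> p0 sfp; apply/span_mod_J/JK; rewrite sfp.
  have -> : j = (d - r)%N by lia.
  by apply: highK => //; lia.
apply: (ker_down_span (P := fun A => polytab (tab2 A) A) (X := fun h => X (iter j U h))
  _ _ _ _ hh Dh).
- move=> A bal cardA.
  have [_ hP DP P1 leadP] := polytab_syt n_gt0 (ballot_syt n_gt0 bal) (size_tab2 A).
  by rewrite second_set_tab2 in hP DP P1 leadP; rewrite -cardA.
- by rewrite iter_lin0.
- by move=> u v; rewrite iter_linD; apply: XD.
move=> c A bal cardA p0 sfp.
have Cq := C_index_tab2 L bal cardA; set q := (_, _) in Cq.
have [kappa k0 sfq] := sfpart_C_elt Cq.
apply: (@congrX _ ((c / kappa) *: C_elt la q)); last first.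
  exact: (span_mod_elt _ (I_ideal0 n la s) _ Cq).
have rE : rank_of q = r by rewrite /rank_of second_set_tab2.
have jE : (d - r = j)%N by lia.
by rewrite sfp linearZ /= sfq scalerA divfK // iter_linZ deg_sigma_index // rE jE second_set_tab2.
Qed.

Lemma free_modC : free_mod J (C_index la s) (C_elt la).
Proof.
move=> rs c uniq_rs all_rs /=; have [JK _ freeK] := adaptedK.
move/JK; rewrite linear_sum /= => Ksum q0 q0rs.
have Cq q : q \in rs -> C_index la s q by move/(allP all_rs).
have [kap kapP] : exists kap : cindex -> rat, forall q, q \in rs -> kap q != 0 /\
    sfpart (C_elt la q) = kap q *: iter (deg_of q - rank_of q) U (polytab q.2 (second_set q.2)).
  clear -Cq n_gt0 LamP SigmaP; elim: rs Cq => [|q rs IHrs] Cq; first by exists (fun=> 0).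
  have [|kap kapP] := IHrs; first by move=> q' q'rs; apply: Cq; rewrite inE q'rs orbT.
  have [k k0 sfk] : _ := sfpart_C_elt (Cq q (mem_head _ _)).
  exists (fun q' => if q' == q then k else kap q') => q'; rewrite inE.
  by case: eqP => [-> | _ /= /kapP].
(* Grouping a relation by rank and degree gives elements of the H_r, each of which vanishes by the
   independence clause of [adapted]. *)
pose h r d := \sum_(q <- rs | (rank_of q == r) && (deg_of q == d))
  (c q * kap q) *: polytab q.2 (second_set q.2).
have Pfacts q : q \in rs -> [/\ q.2 = tab2 (second_set q.2),
    homdeg (rank_of q) (polytab q.2 (second_set q.2)), D (polytab q.2 (second_set q.2)) = 0,
    polytab q.2 (second_set q.2) (second_set q.2) = 1 &
    forall A, polytab q.2 (second_set q.2) A != 0 -> (weight A <= weight (second_set q.2))%N].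
  by move=> /Cq/C_indexP[_ _ sytT le2]; apply: polytab_syt.
have h0 r d : Lam r d -> h r d = 0.
  apply: (freeK h) => [r' d' L | ].
    have [le_rd le_drn _] := LamP L; split; first by lia.
      move=> A; apply: contraNeq => neA; rewrite /h sum_ffunE big_seq_cond big1 // => q.
      case/and3P=> qrs /eqP rq _; rewrite ffunE; have [_ hq _ _ _] := Pfacts q qrs.
      rewrite (_ : polytab _ _ A = 0) ?scaler0 //; apply/eqP.
      by apply: contraTT neA => /hq->; rewrite rq eqxx.
    rewrite /h linear_sum big_seq_cond big1 // => q /and3P[qrs _ _].
    by rewrite linearZ /=; have [_ _ -> _ _] := Pfacts q qrs; rewrite scaler0.
  move: Ksum; congr K.
  pose t q := (c q * kap q) *: iter (deg_of q - rank_of q) U (polytab q.2 (second_set q.2)).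
  rewrite (eq_big_seq t) => [|q qrs]; last first.
    by rewrite linearZ /=; have [_ ->] := kapP q qrs; rewrite scalerA.
  pose g q r' d' := if (rank_of q == r') && (deg_of q == d') then t q else 0.
  transitivity (\sum_(d' < n.+1) \sum_(r' < d'.+1 | Lam r' d') \sum_(q <- rs) g q r' d'); last first.
    apply: eq_bigr => d' _; apply: eq_bigr => r' _; rewrite /h iter_lin_sum [RHS]big_mkcond.
    apply: eq_bigr => q _; rewrite /g /t; case: ifP => // /andP[/eqP<- /eqP<-].
    by rewrite iter_linZ.
  under [RHS]eq_bigr => d' _ do rewrite exchange_big /=.
  rewrite [RHS]exchange_big /=; apply: eq_big_seq => q qrs.
  have [L _ _ _] := C_indexP (Cq q qrs); have [le_rd le_drn _] := LamP L.
  have lt_dn : (deg_of q < n.+1)%N by lia.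
  have lt_rd : (rank_of q < (deg_of q).+1)%N by lia.
  rewrite (bigD1 (Ordinal lt_dn)) //= (bigD1 (Ordinal lt_rd)) //= {1}/g !eqxx /=.
  rewrite !big1 ?addr0 // => [d' ned | r' /andP[_ ner]].
    apply: big1 => r' _; rewrite /g ifF //; apply: contra_neqF ned => /andP[_ /eqP eqd].
    exact/val_inj.
  by rewrite /g ifF //; apply: contra_neqF ner => /andP[/eqP eqr _]; apply/val_inj.
apply/eqP; apply: contraT => c0.
(* Among the terms of this rank and degree with nonzero coefficient, take a second row A of maximal
   weight. Only one term has a coefficient at A, since rank and degree determine (S, mu) and the
   second row determines T. *)
pose good q := [&& q \in rs, c q != 0, rank_of q == rank_of q0 & deg_of q == deg_of q0].
pose goodA A := has (fun q => good q && (second_set q.2 == A)) rs.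
have good0 : goodA (second_set q0.2).
  by apply/hasP; exists q0; rewrite // /good q0rs c0 !eqxx.
case: (arg_maxnP (@weight n) good0) => A /hasP[q1 q1rs /andP[good1 /eqP q1A]] maxA.
have /and4P[_ c1 /eqP r1 /eqP d1] := good1.
have L0 : Lam (rank_of q0) (deg_of q0) by have [] := C_indexP (Cq q0 q0rs).
have := congr1 (fun f : sqfree n => f A) (h0 _ _ L0); rewrite ffunE /h sum_ffunE -big_filter.
set rs' := filter _ rs.
have q1rs' : q1 \in rs' by rewrite mem_filter r1 d1 !eqxx.
rewrite (bigD1_seq q1) ?filter_uniq //= big_seq_cond big1 ?addr0 => [|q /andP[]]; last first.
  rewrite mem_filter => /andP[/andP[rq dq] qrs] neq; rewrite ffunE.
  have [->|cq] := eqVneq (c q) 0; first by rewrite mul0r scale0r.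
  have [TE _ _ _ leadP] := Pfacts q qrs.
  have [->|PA] := eqVneq (polytab q.2 (second_set q.2) A) 0; first by rewrite scaler0.
  have le1 := leadP _ PA.
  have le2 : (weight (second_set q.2) <= weight A)%N.
    by apply: maxA; apply/hasP; exists q; rewrite // /good qrs cq rq dq !eqxx.
  have AE : second_set q.2 = A by apply: weight_inj; apply/eqP; rewrite eqn_leq le1 le2.
  case/eqP: neq; rewrite [q]surjective_pairing [q1]surjective_pairing; congr (_, _).
    have [_ -> _ _] := C_indexP (Cq q qrs); have [_ -> _ _] := C_indexP (Cq q1 q1rs).
    by rewrite r1 d1 (eqP rq) (eqP dq).
  by have [TE1 _ _ _ _] := Pfacts q1 q1rs; rewrite TE TE1 AE q1A.
have [_ _ _ P1 _] := Pfacts q1 q1rs; have [k1 _] := kapP q1 q1rs.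
rewrite ffunE -q1A P1 [_ *: _]mulr1 => /eqP.
by rewrite mulf_eq0 (negPf c1) (negPf k1).
Qed.

Lemma Sigma_shape S mu : Sigma la s (S, mu) ->
  exists r d, [/\ Lam r d, (S, mu) = sigma_index n r d &
    shape S = if r == 0%N then [:: n] else [:: (n - r)%N; r]].
Proof.
move=> /SigmaP[r [d [L Emu]]]; exists r, d; split=> //.
have [le_rd le_drn _] := LamP L.
have -> : S = tab2 (ivl n (start_of n r d) r) by case: Emu.
rewrite shape_tab2 card_ivl //.
by have := start_of_params le_rd le_drn; rewrite /interval_params; lia.
Qed.

(** Injectivity rests on the support: tabloids in these polytabloids use rows 0 and 1 only, so the
    set of second-row entries determines them. *)
Lemma tabset_specht r v : (r <= n - r)%N ->
    v \in specht n (if r == 0%N then [:: n] else [:: (n - r)%N; r]) ->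
  [/\ homdeg r (tabset v), D (tabset v) = 0 & tabset v = 0 -> v = 0].
Proof.
move=> le_r vS.
have [hv Dv sv] : [/\ homdeg r (tabset v), D (tabset v) = 0
      & forall f, v f != 0 -> forall i : 'I_n, (f i <= 1)%N].
  move: v vS; apply: specht_ind => [|u v|c v|t].
  - rewrite !linear0; split=> // [A|f]; by rewrite ffunE eqxx.
  - move=> [hu Du su] [hv Dv sv]; split.
    + move=> A; rewrite linearD ffunE; have [-> | /hu//] := eqVneq (tabset u A) 0.
      by rewrite add0r => /hv.
    + by rewrite !linearD /= Du Dv addr0.
    + move=> f; rewrite ffunE; have [-> | /su//] := eqVneq (u f) 0.
      by rewrite add0r => /sv.
  - move=> [hv Dv sv]; split.
    + by move=> A; rewrite linearZ ffunE scaler_eq0 negb_or => /andP[_ /hv].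
    + by rewrite !linearZ /= Dv scaler0.
    + by move=> f; rewrite ffunE scaler_eq0 negb_or => /andP[_ /sv].
  have [r0 [r1 [tr sz1]]] := reshape_two_row t le_r.
  rewrite (tabset_polytabloid tr); split.
  - by rewrite -sz1 -(card_second_row tr); apply: homdeg_polytab.
  - exact: down_polytab tr.
  move=> f nz i; rewrite leqNgt; apply: contra nz => lt1.
  rewrite sum_ffunE big1 // => tau _; rewrite !ffunE.
  case: eqP => [eqf|_]; last by rewrite scaler0.
  move: lt1; rewrite eqf !ffunE (row_of_two_row tr) inordK.
    by case: (_ \in r1).
  by have := ltn_ord i; case: (_ \in r1); lia.
split=> // tv0; apply/ffunP=> f; rewrite [RHS]ffunE; apply/eqP; apply: contraT => vf.
have := congr1 (fun w : sqfree n => w (ones f)) tv0.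
rewrite /= ffunE sum_ffunE (bigD1 f) //= big1 ?addr0 => [|g neg].
  by rewrite !ffunE eqxx [_ *: _]mulr1 => vf0; rewrite vf0 eqxx in vf.
rewrite !ffunE; case: eqP => [eqo|_]; last by rewrite scaler0.
have [->|vg] := eqVneq (v g) 0; first by rewrite scale0r.
case/eqP: neg; apply/ffunP=> i; apply/val_inj => /=.
move/setP/(_ i): eqo; rewrite !inE; have := sv f vf i; have := sv g vg i.
by case: (f i : nat) (g i : nat) => [|[|?]] [|[|?]].
Qed.

Lemma spans_specht_C S mu : Sigma la s (S, mu) ->
  spans_specht J (shape S) (fun T => C_index la s ((S, mu), T)) (fun T => C_elt la ((S, mu), T)).
Proof.
move=> SigS; have [JK highK freeK] := adaptedK.
have [r [d [L Emu shS]]] := Sigma_shape SigS; rewrite shS.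
have [le_rd le_drn _] := LamP L; have le_r : (r <= n - r)%N by lia.
have JD := @I_idealD n la s; have J0 := I_ideal0 n la s.
exists (@specht_map n (d - r)%N).
have sf_phi v : sfpart (specht_map (d - r) v) = iter (d - r) U (tabset v).
  exact: sfpart_specht_map.
split.
- by move=> t v _; rewrite /= specht_map_act subrr; apply: I_ideal0.
- move=> v /(tabset_specht le_r)[hv Dv inj] /= /JK; rewrite sf_phi => Kv; apply: inj.
  (* Injectivity modulo the ideal: the independence clause applied to a family with one possibly
     nonzero member. *)
  pose h r' d' := if (r' == r) && (d' == d) then tabset v else 0.
  have : h r d = 0; last by rewrite /h !eqxx.
  apply: (freeK h _ _ r d L) => [r' d' L'|].
    have [le_rd' le_drn' _] := LamP L'; split; first by lia.
      by rewrite /h; case: ifP => [/andP[/eqP-> _] //|_] A; rewrite ffunE eqxx.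
    by rewrite /h; case: ifP => _ //; rewrite linear0.
  move: Kv; congr K; have lt_dn : (d < n.+1)%N by lia.
  rewrite (bigD1 (Ordinal lt_dn)) //=.
  rewrite [X in _ = X + _](bigD1 (Ordinal (le_rd : r < d.+1)%N) L) /= /h !eqxx /=.
  rewrite !big1 ?addr0 // => [d' ned | r' /andP[_ ner]].
    apply: big1 => r' _; rewrite ifF ?iter_lin0 //.
    by apply: contra_neqF ned => /andP[_ /eqP eqd]; apply/val_inj.
  rewrite ifF ?iter_lin0 //.
  by apply: contra_neqF ner => /andP[/eqP eqr _]; apply/val_inj.
- move=> v /(tabset_specht le_r)[hv Dv _].
  pose X w := forall p, sfpart p = iter (d - r) U w ->
    in_span_mod J (fun T => C_index la s ((S, mu), T)) (fun T => C_elt la ((S, mu), T)) p.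
  have congrX p1 p2 : sfpart p1 = sfpart p2 ->
      in_span_mod J (fun T => C_index la s ((S, mu), T)) (fun T => C_elt la ((S, mu), T)) p2 ->
      in_span_mod J (fun T => C_index la s ((S, mu), T)) (fun T => C_elt la ((S, mu), T)) p1.
    move=> eq12 sp2; rewrite -[p1](subrK p2); apply: span_modD => //.
    exact/span_mod_J/ideal_eqP.
  suff : X (tabset v) by apply; apply: sf_phi.
  apply: (ker_down_span (P := fun A => polytab (tab2 A) A) _ _ _ _ hv Dv).
  + move=> A bal cardA.
    have [_ hP DP P1 leadP] := polytab_syt n_gt0 (ballot_syt n_gt0 bal) (size_tab2 A).
    by rewrite second_set_tab2 in hP DP P1 leadP; rewrite -cardA.
  + move=> p; rewrite iter_lin0 => sfp; apply: span_mod_J; rewrite -[p]subr0.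
    by apply: ideal_eqP; rewrite sfp linear0.
  + move=> u w Xu Xw p sfp.
    apply: (@congrX _ (sflift (iter (d - r) U u) + sflift (iter (d - r) U w))).
      by rewrite linearD /= !sfliftK sfp iter_linD.
    by apply: span_modD => //; [apply: Xu | apply: Xw]; rewrite sfliftK.
  move=> c A bal cardA p sfp.
  have := C_index_tab2 L bal cardA; rewrite -Emu => Cq.
  have [kappa k0 sfq] := sfpart_C_elt Cq.
  apply: (@congrX _ ((c / kappa) *: C_elt la ((S, mu), tab2 A))).
    have dE : deg_of ((S, mu), tab2 A) = d by rewrite Emu deg_sigma_index.
    have rE : rank_of ((S, mu), tab2 A) = r by rewrite /rank_of second_set_tab2.
    by rewrite sfp linearZ /= sfq scalerA divfK // iter_linZ dE rE second_set_tab2.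
  exact: (span_mod_elt (fun T => C_elt la ((S, mu), T)) J0 _ Cq).
- move=> T CT; have [kappa k0 sfq] := sfpart_C_elt CT.
  have [_ /= q1E sytT le2] := C_indexP CT.
  rewrite /= in sytT le2.
  have [t TE] := syt_reshape n_gt0 sytT.
  have shT : shape T = shape S by case/and3P: CT => _ _ /eqP.
  exists (kappa *: polytabloid T).
    apply: memvZ; rewrite TE shT shS; apply: memv_span.
    by apply: image_f.
  apply: ideal_eqP; rewrite sfq sf_phi linearZ /= iter_linZ.
  have [r0 [r1 [tr QE]]] := syt_tab2_sizes n_gt0 sytT le2.
  rewrite (tabset_polytabloid tr) QE.
  have rT : rank_of ((S, mu), T) = r.
    have [L' _ _ _] := C_indexP CT; have [le_rd' le_drn' _] := LamP L'.
    have p1 := start_of_params le_rd le_drn.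
    have p2 := start_of_params le_rd' le_drn'.
    have := tab2_inj n_gt0 (congr1 fst (etrans (esym q1E) Emu)).
    move/(congr1 (fun A : {set 'I_n} => #|A|)).
    have le_n c r' : interval_params n c r' -> (c + r' <= n)%N by rewrite /interval_params; lia.
    by rewrite (card_ivl (le_n _ _ p1)) (card_ivl (le_n _ _ p2)).
  by rewrite rT {1}Emu deg_sigma_index.
Qed.

End Main.

Local Open Scope nat_scope.

Theorem theoremD (n k : nat) (la : seq nat)
    (n_gt0 : 0 < n) (le_kn : k <= n)
    (la_part : is_part la) (la_sum : sumn la = k) (la_two_rows : size la <= 2) :
  higher_specht_basis n la (size la).
Proof.
have main s Lam (K : sqfree n -> Prop) : adapted la s Lam K ->
    (forall r d, Lam r d -> [/\ r <= d, d + r <= n & r = 0 -> d <= n - sumn la]) ->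
    (forall (S : tableau n) mu,
      Sigma la s (S, mu) <-> exists r d, Lam r d /\ (S, mu) = sigma_index n r d) ->
    higher_specht_basis n la s.
  move=> adK LamP SigP; split; first split.
  - exact: span_modC adK LamP SigP.
  - exact: free_modC adK LamP SigP.
  - exact: spans_specht_C adK LamP SigP.
subst k; case: la la_part la_two_rows le_kn main => [|a [|b []]] // part_la _ le_n main.
- have noSigma q : Sigma [::] 0 q = false by rewrite /Sigma ltn0 !andbF.
  (* With s = 0 the generator x_i^0 is 1; a variable exists because n > 0. *)
  have J1 (p : {mpoly rat[n]}) : I_ideal [::] 0 p.
    by have := I_idealM p (I_ideal_var [::] 0 (Ordinal n_gt0)); rewrite expr0 mulr1.
  split; last by move=> S mu; rewrite noSigma.
  split=> [p|r c _ all_r _ q /(allP all_r)]; first by exists [::], (fun=> 0%R).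
  by rewrite /C_index noSigma.
- have a_gt0 : 0 < a by move: part_la; rewrite /is_part /= !inE; lia.
  rewrite /= addn0 in le_n; apply: (main 1 Lambda1 (@K1 n)); first exact: adapted1.
    by move=> r d /andP[/eqP-> /eqP->].
  by move=> S mu; apply: SigmaE1 => //; rewrite a_gt0.
have /andP[b_gt0 le_ba] : 0 < b <= a by move: part_la; rewrite /is_part /= !inE; lia.
rewrite /= addn0 in le_n; apply: (main 2 (Lambda2 n a b) (@K2 n a b)); first exact: adapted2.
  by move=> r d; rewrite /Lambda2 /=; split; lia.
by move=> S mu; apply: SigmaE2 => //; rewrite b_gt0.
Qed.
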